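(* Let $\Lambda=A\bar A$ be a system of $n=n_A+n_{\bar A}$ qudits with $n_A\le n_{\bar A}$, so that $\mathcal{H}^{\Lambda}=\mathcal{H}^{A}\otimes\mathcal{H}^{\bar A}$ with $\mathcal{H}^{A}=(\mathbb{C}^d)^{\otimes n_A}$ and $\mathcal{H}^{\bar A}=(\mathbb{C}^d)^{\otimes n_{\bar A}}$. Let $\mathcal{K}\subset\mathcal{H}^{\Lambda}$ be any $D_{\mathcal{K}}$-dimensional subspace, let $\Pi_{\mathcal{K}}^{\Lambda}$ be the projection onto $\mathcal{K}$, and define the states $$\Omega_{\mathcal{K}}^{A}:=\mathrm{Tr}_{\bar A}\Bigl[\tfrac{\Pi_{\mathcal{K}}^{\Lambda}}{D_{\mathcal{K}}}\Bigr],\qquad \Omega_{\mathcal{K}}^{\bar A}:=\mathrm{Tr}_{A}\Bigl[\tfrac{\Pi_{\mathcal{K}}^{\Lambda}}{D_{\mathcal{K}}}\Bigr]$$ on $A$ and $\bar A$, respectively. Then, for a Haar random state $|\phi\rangle\sim\mathsf{H}_{\mathcal{K}}$ in $\mathcal{K}$ and every $\epsilon>0$, it holds that $$\mathrm{Prob}_{|\phi\rangle\sim\mathsf{H}_{\mathcal{K}}}\bigl[E_A(|\phi\rangle)\ge\bar S(\mathcal{K})-\epsilon\bigr]>1-\exp\Bigl[-\frac{(D_{\mathcal{K}}+1)\,\epsilon^2}{72\pi^3\,\ln 2\,(\ln R_{\mathcal{K}})^2}\Bigr],$$ where $$\bar S(\mathcal{K}):=-\log\bigl[\mathrm{Tr}(\Omega_{\mathcal{K}}^{A})^2+\mathrm{Tr}(\Omega_{\mathcal{K}}^{\bar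 A})^2\bigr]-\log\Bigl[1-\frac{1}{D_{\mathcal{K}}+1}\Bigr],$$ and $R_{\mathcal{K}}:=\max_{|\phi\rangle\in\mathcal{K}}\dim\mathrm{supp}(\phi^{A})$ is the maximal rank of the reduced state $\phi^A=\mathrm{Tr}_{\bar A}[|\phi\rangle\langle\phi|]$ over pure states (unit vectors) $|\phi\rangle$ in $\mathcal{K}$.
   Context: $\log$ denotes the logarithm to base $2$ and $\ln$ the natural logarithm. For a unit vector $|\phi\rangle\in\mathcal{H}^{\Lambda}$, the entanglement entropy is $E_A(|\phi\rangle):=S(\phi^A)$, where $\phi^A=\mathrm{Tr}_{\bar A}[|\phi\rangle\langle\phi|]$ is the reduced density matrix on $A$ and $S(\rho):=-\mathrm{Tr}[\rho\log\rho]$ is the von Neumann entropy. A Haar random state $|\phi\rangle\sim\mathsf{H}_{\mathcal{K}}$ is $|\phi\rangle=U|\phi_0\rangle$, where $|\phi_0\rangle\in\mathcal{K}$ is a fixed unit vector and $U$ is distributed according to the Haar probability measure on the unitary group of $\mathcal{K}$; equivalently, $|\phi\rangle$ is uniformly distributed on the unit sphere of $\mathcal{K}$. *)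

(* Defs.v *)
From HB Require Import structures.
From mathcomp Require Import all_boot all_order all_algebra.
From mathcomp Require Import complex.
From mathcomp Require Import all_classical all_reals all_analysis.

Set Implicit Arguments.
Unset Strict Implicit.
Unset Printing Implicit Defensive.
Import Order.TTheory GRing.Theory Num.Theory.
Import numFieldNormedType.Exports.
Local Open Scope classical_set_scope.
Local Open Scope ring_scope.
Local Open Scope sesquilinear_scope.

(* The field R[i] as a [numClosedFieldType]: in this form, matrices over it
   carry the canonical (entrywise) topology. *)
Definition Cx (R : realType) : numClosedFieldType := R[i].

Definition re (R : realType) (z : Cx R) : R := complex.Re z.
Definition ofR (R : realType) (x : R) : Cx R := x%:C%C.

Definition log2 (R : realType) (x : R) : R := ln x / ln 2.

(* Kets are column vectors. *)
Definition unit_vector (R : realType) n (phi : 'cV[Cx R]_n) : Prop :=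
  phi^t* *m phi = 1%:M.

Definition ketbra (R : realType) n (phi : 'cV[Cx R]_n) : 'M[Cx R]_n :=
  phi *m phi^t*.

(* In C^m (x) C^n = C^(m * n), the basis vector |i> (x) |j> has index
   [mxvec_index i j]; [ptrace2] and [ptrace1] trace out the second and the
   first factor. *)
Definition ptrace2 (R : realType) m n (M : 'M[Cx R]_(m * n)) : 'M[Cx R]_m :=
  \matrix_(i, i') \sum_j M (mxvec_index i j) (mxvec_index i' j).

Definition ptrace1 (R : realType) m n (M : 'M[Cx R]_(m * n)) : 'M[Cx R]_n :=
  \matrix_(j, j') \sum_i M (mxvec_index i j) (mxvec_index i j').

(* Spectral functional calculus f(A), for A Hermitian. *)
Definition mxfun (R : realType) n (f : R -> R) (A : 'M[Cx R]_n) : 'M[Cx R]_n :=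
  invmx (spectralmx A)
    *m diag_mx (map_mx (fun z => ofR (f (re z))) (spectral_diag A))
    *m spectralmx A.

(* The convention 0 log 0 = 0 holds since [ln 0 = 0]; the trace is real. *)
Definition vN_entropy (R : realType) n (rho : 'M[Cx R]_n) : R :=
  - re (\tr (rho *m mxfun (@log2 R) rho)).

Definition purity (R : realType) n (rho : 'M[Cx R]_n) : R :=
  re (\tr (rho *m rho)).

Definition ent_entropy (R : realType) m n (phi : 'cV[Cx R]_(m * n)) : R :=
  vN_entropy (ptrace2 (ketbra phi)).

(* Orthogonal projection onto K. [proj_ortho] acts on row vectors from the
   right, hence the transpositions; see [orthoprojP]. *)
Definition orthoproj (R : realType) n (K : {vspace 'cV[Cx R]_n}) : 'M[Cx R]_n :=
  (proj_ortho (\matrix_(i < \dim K) ((vbasis K)`_i)^T))^T.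

Lemma orthoprojP (R : realType) n (K : {vspace 'cV[Cx R]_n}) :
  [/\ (orthoproj K)^t* = orthoproj K,
      orthoproj K *m orthoproj K = orthoproj K,
      forall v, orthoproj K *m v \in K &
      forall v, v \in K -> orthoproj K *m v = v].
Proof.
set B := \matrix_(i < \dim K) ((vbasis K)`_i)^T.
have inK (v : 'cV[Cx R]_n) : (v \in K) = (v^T <= B)%MS.
  apply/idP/submxP => [/coord_vbasis ->|[c vE]].
    exists (\row_i coord (vbasis K) i v).
    rewrite mulmx_sum_row linear_sum; apply: eq_bigr => i _.
    by rewrite linearZ rowK mxE.
  rewrite -[v]trmxK vE mulmx_sum_row linear_sum.
  apply: memv_suml => i _; rewrite linearZ rowK /= trmxK.
  by apply: memvZ; apply: vbasis_mem; apply: mem_nth; rewrite size_tuple.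
set P := proj_ortho B.
have PB m (W : 'M[Cx R]_(m, n)) : (W *m P <= B)%MS by exact: proj_ortho_sub.
have PP : P *m P = P by exact: proj_ortho_proj.
have HP : P *m P^t* = P^t*.
  have := proj_ortho_compl_sub B (1%:M : 'M[Cx R]_n).
  rewrite mul1mx -/P -(eqmx_ortho _ (proj_orthoE B)) => /orthomx1P /eqP.
  by rewrite mulmxBl mul1mx subr_eq0 => /eqP.
have P_herm : P^t* = P.
  have := congr1 (fun M => M^t*) HP.
  by rewrite /= trmx_mul map_mxM /= trmxCK HP.
split.
- by rewrite /orthoproj -/B -/P -[in RHS]P_herm map_trmx.
- by rewrite /orthoproj -/B -/P -trmx_mul PP.
- by move=> v; rewrite inK trmx_mul trmxK PB.
- by move=> v; rewrite inK => vB; apply: trmx_inj;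
    rewrite trmx_mul trmxK proj_ortho_id.
Qed.

(* The unitary group of K, acting as the identity on the complement of K. *)
Definition unitary_group (R : realType) n (K : {vspace 'cV[Cx R]_n}) :
    set 'M[Cx R]_n :=
  [set U | U \is unitarymx
           /\ U *m (1%:M - orthoproj K) = 1%:M - orthoproj K].

(* Borel sigma-algebra of the entrywise topology. *)
Definition borelM (R : realType) n := g_sigma_algebraType (@open 'M[Cx R]_n).

(* [unitary_group K] is a compact group, so these conditions determine mu. *)
Definition is_haar (R : realType) n (K : {vspace 'cV[Cx R]_n})
    (mu : probability (borelM R n) R) : Prop :=
  mu (unitary_group K) = 1%E /\
  forall V : 'M[Cx R]_n, unitary_group K V ->
  forall X : set (borelM R n), measurable X ->
    mu ((fun U : 'M[Cx R]_n => V *m U) @^-1` X) = mu X.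

Definition Omega (R : realType) n (K : {vspace 'cV[Cx R]_n}) : 'M[Cx R]_n :=
  (\dim K)%:R^-1 *: orthoproj K.

Definition Sbar (R : realType) m n (K : {vspace 'cV[Cx R]_(m * n)}) : R :=
  - log2 (purity (ptrace2 (Omega K)) + purity (ptrace1 (Omega K)))
  - log2 (1 - 1 / ((\dim K)%:R + 1)).

(* The ranks of the reduced states take values in {0, ..., m}, so the maximum
   over all unit vectors of K is taken over their set of values; the rank is
   the dimension of the support. *)
Definition max_rank (R : realType) m n (K : {vspace 'cV[Cx R]_(m * n)}) : nat :=
  (\max_(r < m.+1 |
     `[< exists phi : 'cV[Cx R]_(m * n),
           [/\ phi \in K, unit_vector phi &
               \rank (ptrace2 (ketbra phi)) = r] >]) r)%N.

(* Main.v *)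
(* Write f for the entropy of the reduced state in nats. At phi its derivative
   along a tangent direction v is 2 Re <g, v>, where g = f'(rho^A) acting on
   phi, and |g|^2 = sum_i x_i (1 + ln x_i)^2 over the Schmidt weights x_i is
   bounded in terms of the maximal rank. To avoid the singularity of f at
   non-full rank, f is replaced by the concave polynomials obtained by
   truncating the Taylor series of - x ln x at x = 1, which decrease to it
   uniformly; Klein's inequality gives the first order expansion.

   Concentration of f on the sphere of K is proved without Levy's lemma. For
   orthonormal a, c in K, invariance lets us average c over random signs in an
   orthonormal basis, so one small rotation of a towards c changes f by a
   Rademacher sum with variance O(|g|^2 / (D - 1)), up to second order.
   Convexity of exp along a path of k -> oo small rotations then bounds the
   exponential moments of f(U b) - f(U a) by those of a Gaussian, and averaging
   over b and Markov's inequality yield the deviation bound.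

   The mean is bounded below by Jensen's inequality, f >= 1 - ln c - purity / c
   with c the mean purity, which polarization over the fourth roots of unity
   reduces to a sum over pairs of basis vectors that does not depend on U. *)
Require Import Defs.
From HB Require Import structures.
From mathcomp Require Import all_boot all_order all_algebra.
From mathcomp Require Import complex.
From mathcomp Require Import all_classical all_reals all_analysis.
From mathcomp Require Import measurable_realfun.
From mathcomp Require Import ring lra.
Import Order.TTheory GRing.Theory Num.Theory.
Import numFieldNormedType.Exports.
Local Open Scope classical_set_scope.
Local Open Scope ring_scope.
Local Open Scope sesquilinear_scope.
Set Implicit Arguments.
Unset Strict Implicit.
Unset Printing Implicit Defensive.

(** * Scalar inequalities *)

(** The truncation order [N] costs nothing in the final exponent. Bounds that grow with [N] occur
    only in the second-order term of a single rotation, which vanishes as the steps shrink, so [N]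
    may be chosen after [eps]. The argument takes place on the group. Left invariance is all that is
    given; right invariance, which exchanges the vectors [x] in [U *m x], follows from inversion and
    Fubini, and transitivity on unit vectors is realized by explicit reflection-like unitaries. On
    the constants: up to a phase two unit vectors are at angle at most pi/2, and the optimal Markov
    bound has exponent t^2 (D + 1) / (6 pi^2 L), where L = 3 + 4 (ln R)^2, t is slightly below
    [ln 2 * eps], and R is the maximal rank. Compared with the stated exponent this leaves a factor
    of about 12 pi (ln 2)^3 (ln R)^2 / L, which exceeds 1 as soon as R >= 2. The surplus pays for
    the truncation and gives the strict inequality. It is smallest at R = 2, which is why numerical
    bounds on [ln 2] and [pi] are proved. *)

Section Scalar.
Variable R : realType.
Implicit Types (x y u v : R) (N n : nat).

Lemma convex_exprn u v n : 0 <= u -> 0 <= v ->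
  u ^+ n.+1 + n.+1%:R * u ^+ n * (v - u) <= v ^+ n.+1.
Proof.
move=> u0 v0; elim: n => [|n IH]; first by rewrite !expr1 expr0; lra.
rewrite [leRHS]exprS; apply: le_trans (ler_wpM2l v0 IH).
have un0 : 0 <= u ^+ n by rewrite exprn_ge0.
rewrite -subr_ge0 -(natr1 n.+1) !exprS.
set U := u ^+ n in un0 *; set k := n.+1%:R : R.
have -> : v * (u * U + k * U * (v - u))
  - (u * (u * U) + (k + 1) * (u * U) * (v - u)) = k * U * (v - u) ^+ 2.
  by ring.
by rewrite mulr_ge0 ?sqr_ge0// mulr_ge0.
Qed.

(** Taylor polynomial of [- ln x] at 1. *)
Definition logser N x : R := \sum_(k < N) (1 - x) ^+ k.+1 / k.+1%:R.

(* The partial sums of [- x ln x = u - sum_(k >= 2) u^k / (k (k - 1))], where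
   [u = 1 - x]; they are concave polynomials. *)
Definition eta N x : R :=
  (1 - x) - \sum_(k < N) (1 - x) ^+ k.+2 / (k.+1%:R * k.+2%:R).

Definition deta N x : R := logser N x - 1.

(** Concavity, by induction on [N]: each new term subtracts a convex power of 1 - x, and the slope
    of its tangent is the term that [logser] gains, so [deta] is the derivative of [eta]. *)
Lemma eta_tangent N x y : x <= 1 -> y <= 1 ->
  eta N y <= eta N x + (y - x) * deta N x.
Proof.
move=> x1 y1; rewrite /eta /deta /logser; elim: N => [|N IH].
  by rewrite !big_ord0; lra.
rewrite !big_ord_recr /=.
have := @convex_exprn (1 - x) (1 - y) N.+1 ltac:(lra) ltac:(lra).
move: IH; set A := \sum_(i < N) _; set B := \sum_(i < N) _.
set C := \sum_(i < N) _.
move=> IH /(ler_wpM2r (ltac:(by rewrite invr_ge0 mulr_ge0) :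
  0 <= (N.+1%:R * N.+2%:R : R)^-1)).
set a : R := (1 - x) ^+ N.+2; set b : R := (1 - x) ^+ N.+1.
set c : R := (1 - y) ^+ N.+2.
have -> : (a + N.+2%:R * b * (1 - y - (1 - x))) / (N.+1%:R * N.+2%:R) =
  a / (N.+1%:R * N.+2%:R) + b / N.+1%:R * (x - y).
  have n1 : (N.+1%:R : R) != 0 by rewrite pnatr_eq0.
  have n2 : (N.+2%:R : R) != 0 by rewrite pnatr_eq0.
  by move: n1 n2; set p := N.+1%:R; set q := N.+2%:R => n1 n2; field; apply/andP.
move: (a / _) (c / _) (b / _) IH => a' c' b'.
by clearbody A B C; lra.
Qed.

Lemma is_derive_logser N x : is_derive x 1 (logser N)
  (- \sum_(k < N) (1 - x) ^+ k).
Proof.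
rewrite (_ : logser N = \sum_(k < N) (fun y => (1 - y) ^+ k.+1 / k.+1%:R)); last first.
  by apply/funext => y; rewrite fct_sumE.
rewrite -sumrN; apply: is_derive_sum => i.
have H : is_derive x 1 (fun y : R => 1 - y) (-1).
  have := is_deriveB (is_derive_cst (1:R) x 1) (is_derive_id x 1).
  by rewrite sub0r.
have H2 := is_deriveX i.+1 H.
have := is_deriveM H2 (is_derive_cst (i.+1%:R^-1 : R) x 1).
congr (is_derive _ _ _ _).
  by apply/funext => y; rewrite /= exprfctE.
rewrite /cst/= scaler0 add0r /GRing.scale /=.
have n1 : (i.+1%:R : R) != 0 by rewrite pnatr_eq0.
by move: n1; set p := i.+1%:R => n1; field.
Qed.

Lemma geom_sum1B N x : x * \sum_(k < N) (1 - x) ^+ k = 1 - (1 - x) ^+ N.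
Proof.
elim: N => [|N IH]; first by rewrite big_ord0 expr0; ring.
by rewrite big_ord_recr /= mulrDr IH exprS; ring.
Qed.

Lemma logser1 N : logser N 1 = 0.
Proof. by rewrite /logser big1 // => k _; rewrite subrr expr0n mul0r. Qed.

(** The derivative of ln y + [logser N y] is (1 - y)^N / y by the geometric sum, so this function
    increases up to its value 0 at y = 1. *)
Lemma logser_le_ln N x : 0 < x -> x <= 1 -> logser N x <= - ln x.
Proof.
move=> x0 x1.
pose f y := ln y + logser N y.
suff : f x <= f 1.
  by rewrite /f ln1 add0r logser1; lra.
have df y : 0 < y -> is_derive y 1 f (y^-1 - \sum_(k < N) (1 - y) ^+ k).
  by move=> y0; apply: is_deriveD; [exact: is_derive1_ln|exact: is_derive_logser].
apply: (@ger0_derive1_ndecr _ f x 1) => //.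
- by move=> y /[!in_itv]/= /andP[xy _]; apply: ex_derive; apply: df; lra.
- move=> y /[!in_itv]/= /andP[xy y1]; rewrite derive1E.
  have y0 : 0 < y by lra.
  rewrite (@derive_val _ _ _ _ _ _ _ (df _ y0)).
  rewrite -(pmulr_rge0 _ y0) mulrBr divff ?gt_eqF// geom_sum1B subKr.
  by rewrite exprn_ge0// subr_ge0 ltW.
- apply: derivable_within_continuous => y /[!in_itv]/= /andP[xy _].
  by apply: ex_derive; apply: df; lra.
Qed.

Lemma ln_le_logser N x : 0 < x -> x <= 1 ->
  x * (- ln x - logser N x) <= (1 - x) ^+ N.+1 / N.+1%:R.
Proof.
move=> x0 x1; rewrite -ler_pdivlMl//.
(* The error term is written as a difference of two [logser], so that [is_derive_logser]
   differentiates it. With the factor 1/x frozen, the derivative is (1 - y)^N (1/x - 1/y),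
   nonnegative for y >= x. *)
pose f y := - (ln y + logser N y) - x^-1 * logser N.+1 y
   + x^-1 * logser N y.
have fE y : f y = - (ln y + logser N y) - x^-1 * ((1 - y) ^+ N.+1 / N.+1%:R).
  rewrite /f [logser N.+1 y]/logser big_ord_recr /= -/(logser N y); ring.
suff : f x <= f 1.
  rewrite !fE ln1 logser1 subrr expr0n mul0r mulr0 !(addr0, oppr0).
  by rewrite subr_le0 opprD.
have df y : 0 < y -> is_derive y 1 f
   (- (y^-1 - \sum_(k < N) (1 - y) ^+ k) - x^-1 * (- \sum_(k < N.+1) (1 - y) ^+ k)
     + x^-1 * (- \sum_(k < N) (1 - y) ^+ k)).
  move=> y0; apply: is_deriveD; [apply: is_deriveB|].
  - apply: is_deriveN; apply: is_deriveD; [exact: is_derive1_ln|exact: is_derive_logser].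
  - exact: (is_deriveZ _ (is_derive_logser N.+1 y)).
  - exact: (is_deriveZ _ (is_derive_logser N y)).
apply: (@ger0_derive1_ndecr _ f x 1) => //.
- by move=> y /[!in_itv]/= /andP[xy _]; apply: ex_derive; apply: df; lra.
- move=> y /[!in_itv]/= /andP[xy y1]; rewrite derive1E.
  have y0 : 0 < y by lra.
  rewrite (@derive_val _ _ _ _ _ _ _ (df _ y0)).
  have -> : - (y^-1 - \sum_(k < N) (1 - y) ^+ k)
     - x^-1 * (- \sum_(k < N.+1) (1 - y) ^+ k)
     + x^-1 * (- \sum_(k < N) (1 - y) ^+ k) =
     (y * \sum_(k < N) (1 - y) ^+ k - 1) / y + x^-1 * (1 - y) ^+ N.
    by rewrite big_ord_recr /=; field; rewrite !gt_eqF.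
  rewrite geom_sum1B addrAC subrr sub0r mulNr mulrC addrC -mulrBl.
  by rewrite mulr_ge0 ?exprn_ge0 ?subr_ge0 ?lef_pV2 ?ltW.
- apply: derivable_within_continuous => y /[!in_itv]/= /andP[xy _].
  by apply: ex_derive; apply: df; lra.
Qed.

(** Carries the two bounds on [logser] over to [eta]. At x = 0 it also evaluates [eta N 0] to 1/(N +
    1), the endpoint that the logarithmic bounds exclude. *)
Lemma mul_logser N x : x * logser N x = eta N x - (1 - x) ^+ N.+1 / N.+1%:R.
Proof.
rewrite /eta; elim: N => [|N IH].
  by rewrite /logser !big_ord0 mulr0 expr1 divr1; ring.
rewrite /logser big_ord_recr mulrDr /= -/(logser N x) IH big_ord_recr /=.
set B := \sum_(i < N) _; rewrite !(exprS _ N.+1); set a : R := (1 - x) ^+ N.+1.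
have n1 : (N.+1%:R : R) != 0 by rewrite pnatr_eq0.
rewrite -(natr1 N.+1); have : (N.+1%:R + 1 : R) != 0 by rewrite natr1 pnatr_eq0.
move: n1; set p := N.+1%:R => n1 n2; clearbody B a p; field.
by rewrite n1 n2.
Qed.

Lemma eta_ge N x : 0 <= x -> x <= 1 -> - (x * ln x) <= eta N x.
Proof.
rewrite le_eqVlt => /predU1P[<- _|x0 x1].
  have := mul_logser N 0; rewrite !mul0r !(oppr0, addr0) expr1n => /esym/subr0_eq ->.
  by rewrite divr_ge0.
have := ln_le_logser N x0 x1; have := mul_logser N x; rewrite mulrBr mulrN.
by move: (x * ln x) (x * logser N x) (_ / N.+1%:R) => a b c; lra.
Qed.

Lemma eta_le N x : 0 <= x -> x <= 1 -> eta N x <= - (x * ln x) + N.+1%:R^-1.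
Proof.
rewrite le_eqVlt => /predU1P[<- _|x0 x1].
  have := mul_logser N 0; rewrite !mul0r !(oppr0, addr0) expr1n => /esym/subr0_eq ->.
  by rewrite add0r div1r.
have := ler_wpM2l (ltW x0) (logser_le_ln N x0 x1); rewrite mulrN.
have := mul_logser N x.
have : (1 - x) ^+ N.+1 / N.+1%:R <= N.+1%:R^-1 :> R.
  by rewrite ler_piMl ?invr_ge0// exprn_ile1//; lra.
move: N.+1%:R^-1 => d.
by move: (x * ln x) (x * logser N x) (_ * d) => a b c; lra.
Qed.

Lemma logser_ge0 N x : x <= 1 -> 0 <= logser N x.
Proof.
by move=> x1; apply: sumr_ge0 => k _; rewrite divr_ge0// exprn_ge0// subr_ge0.
Qed.

Lemma deta_sqr_le N x : 0 < x -> x <= 1 -> deta N x ^+ 2 <= 1 + ln x ^+ 2.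
Proof.
move=> x0 x1; have h0 := logser_ge0 N x1; have hl := logser_le_ln N x0 x1.
by rewrite /deta; nra.
Qed.

(** The growth in [N] is harmless: this bound enters only the quadratic term of a rotation step. *)
Lemma deta_norm_le N x : 0 <= x -> x <= 1 -> `|deta N x| <= N.+1%:R.
Proof.
move=> x0 x1; have h0 := logser_ge0 N x1.
have hN : logser N x <= N%:R.
  rewrite /logser -[X in X%:R](card_ord N) -sum1_card natr_sum.
  apply: ler_sum => k _.
  rewrite ler_pdivrMr// mul1r (@le_trans _ _ 1)//; last by rewrite ler1n.
  by rewrite exprn_ile1//; lra.
by rewrite /deta ler_norml -natr1; lra.
Qed.

End Scalar.

Section ScalarBounds.
Variable R : realType.
Implicit Types (x y u v : R) (N n : nat).

Lemma xln2_le1 y : 0 < y -> y <= 1 -> y * ln y ^+ 2 <= 1.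
Proof.
move=> y0 y1.
(* With y = w^4 the claim becomes 4 w^2 |ln w| <= 1, and - ln w <= 1/w - 1 bounds the left side by 4
   w (1 - w). *)
pose w : R := Num.sqrt (Num.sqrt y).
have w0 : 0 < w by rewrite !sqrtr_gt0.
have wE : w ^+ 4 = y by rewrite (exprM _ 2 2) !sqr_sqrtr ?ltW// sqrtr_gt0.
have w1 : w <= 1 by rewrite -(@ler_pXn2r _ 4) ?nnegrE ?wE ?expr1n ?ler01 ?(ltW w0).
have lw : ln y = 4 * ln w by rewrite -wE lnXn// mulr_natl.
have lw0 : ln w <= 0 by rewrite ln_le0.
have lw1 : - ln w <= w^-1 - 1.
  rewrite -lnV ?posrE//.
  by have := @le_ln1Dx _ (w^-1 - 1); rewrite addrCA subrr addr0; apply;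
    rewrite ltrBrDl subrr invr_gt0.
have {lw1} lw1 : w * - ln w <= 1 - w.
  by have := ler_wpM2l (ltW w0) lw1; rewrite mulrBr divff ?gt_eqF// mulr1.
have h : w ^+ 2 * - ln w <= 1 / 4.
  have := ler_wpM2l (ltW w0) lw1; rewrite mulrA -expr2.
  have := sqr_ge0 (w - 1 / 2); nra.
have h0 : 0 <= w ^+ 2 * - ln w by rewrite mulr_ge0 ?sqr_ge0// oppr_ge0.
have -> : y * ln y ^+ 2 = (4 * (w ^+ 2 * - ln w)) ^+ 2 by rewrite lw -wE; ring.
by nra.
Qed.

(** The idea is to split ln x = ln (r x) - ln r. Where r x <= 1, [xln2_le1] gives x ln (r x)^2 <=
    1/r, and the at most r nonzero weights contribute at most 1 in total; where r x > 1, ln (r x)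
    lies between 0 and ln r. Squaring the difference costs a factor 2, so the sum of x (ln x)^2 is
    at most 2 + 4 (ln r)^2; the remaining 1 comes from [deta_sqr_le]. *)
Lemma sum_deta_sqr_le N m r (x : 'I_m -> R) : (0 < r)%N ->
  (forall i, 0 <= x i) -> \sum_i x i = 1 -> (#|[pred i | x i != 0%R]| <= r)%N ->
  \sum_i x i * deta N (x i) ^+ 2 <= 3 + 4 * ln r%:R ^+ 2.
Proof.
move=> r0 x0 x1 xr; have rp : 0 < r%:R :> R by rewrite ltr0n.
set l : R := ln r%:R; have l0 : 0 <= l by rewrite ln_ge0// ler1n.
have xle1 i : x i <= 1.
  by rewrite -x1 (bigD1 i)//= lerDl sumr_ge0.
have key i : x i * deta N (x i) ^+ 2 <=
    (if x i != 0 then 2 / r%:R else 0) + x i * (1 + 4 * l ^+ 2).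
  case: eqP => [->|/eqP xn0] /=; first by rewrite !mul0r addr0.
  have xp : 0 < x i by rewrite lt0r xn0 x0.
  apply: le_trans (ler_wpM2l (x0 i) (deta_sqr_le N xp (xle1 i))) _.
  have lnE : ln (x i) = ln (r%:R * x i) - l by rewrite lnM ?posrE// addrC addKr.
  set t := ln (r%:R * x i) in lnE.
  have : x i * t ^+ 2 <= 1 / r%:R + x i * l ^+ 2.
    have [rx|rx] := leP (r%:R * x i) 1.
      have rx0 : 0 < r%:R * x i by rewrite mulr_gt0.
      have := xln2_le1 rx0 rx; rewrite -/t -mulrA mulrC -ler_pdivlMr// => h.
      by rewrite (le_trans h)// lerDl mulr_ge0 ?sqr_ge0.
    have t0 : 0 <= t by rewrite ln_ge0// ltW.
    have tl : t <= l.
      by rewrite ler_ln ?posrE ?mulr_gt0// ler_piMr// ltW.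
    rewrite -[leLHS]add0r lerD ?divr_ge0 ?(ltW rp)//.
    by rewrite ler_pM2l// ler_pXn2r ?nnegrE.
  have h2 : ln (x i) ^+ 2 <= 2 * t ^+ 2 + 2 * l ^+ 2.
    by rewrite lnE; have := sqr_ge0 (t + l); nra.
  have := ler_wpM2l (x0 i) h2.
  rewrite !mulrDr mulr1 !(mulrCA _ 2) (mulrCA _ 4).
  rewrite (_ : 2 / r%:R = 2 * (1 / r%:R)); last by rewrite mul1r.
  by move: (x i * ln _ ^+ 2) (x i * t ^+ 2) (x i * l ^+ 2) (1 / r%:R) => a b c d; lra.
apply: le_trans (ler_sum _ (fun i _ => key i)) _.
rewrite big_split /= -mulr_suml x1 mul1r -big_mkcond /= sumr_const.
have : (2 / r%:R) *+ #|[pred i | x i != 0]| <= 2 :> R.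
  rewrite -mulr_natr -mulrA -[leRHS]mulr1 ler_pM2l// ler_pdivrMl// mulr1 ler_nat.
  exact: xr.
lra.
Qed.

(** For y >= 0 the product of exp (- y^2 / 2) and cosh y decreases, because sinh y <= y cosh y. *)
Lemma cosh_le y : (expR y + expR (- y)) / 2 <= expR (y ^+ 2 / 2).
Proof.
wlog y0 : y / 0 <= y => [H|].
  have [|y0] := leP 0 y; first exact: H.
  by have := H (- y) ltac:(lra); rewrite opprK sqrrN [expR (- y) + _]addrC.
have dN (z : R) : is_derive z 1 (fun t : R => expR (- t)) (- expR (- z)).
  have := @is_derive1_comp R expR -%R z _ _ (is_derive_expR (- z)) (is_deriveNid z 1).
  by rewrite mulrN1.
have dx (z : R) : is_derive z 1 (fun t : R => t) 1 := is_derive_id z 1.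
have sinh_le (z : R) : 0 <= z -> expR z - expR (- z) <= z * (expR z + expR (- z)).
  move=> z0.
  pose k (t : R) : R := t * (expR t + expR (- t)) - (expR t - expR (- t)).
  suff : k 0 <= k z by rewrite /k oppr0 mul0r !subrr subr_ge0.
  have dk (t : R) : is_derive t 1 k (t * (expR t - expR (- t))).
    rewrite /k; apply: is_derive_eq; rewrite /GRing.scale /=; ring.
  apply: (@ger0_derive1_ndecr _ k 0 z) => //.
  - by move=> t /[!in_itv]/= /andP[t0 _]; rewrite derive1E derive_val
      mulr_ge0 ?(ltW t0)// subr_ge0 ler_expR; lra.
  - by apply: derivable_within_continuous => t _; exact: ex_derive.
pose f (t : R) : R := expR (- (t ^+ 2 / 2)) * (expR t + expR (- t)).
have d2 (z : R) : is_derive z 1 (fun t : R => expR (- (t ^+ 2 / 2)))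
    (- z * expR (- (z ^+ 2 / 2))).
  have d3 : is_derive z 1 (fun t : R => - (t ^+ 2 / 2)) (- z).
    rewrite (_ : (fun _ => _) = fun t : R => (- 1 / 2) * (t ^+ 2)); last first.
      by apply/funext => t; field.
    by apply: is_derive_eq; rewrite /GRing.scale /=; field.
  by have := @is_derive1_comp R expR _ z _ _ (is_derive_expR _) d3; rewrite mulrC.
have df (t : R) : is_derive t 1 f (expR (- (t ^+ 2 / 2)) *
    ((expR t - expR (- t)) - t * (expR t + expR (- t)))).
  by rewrite /f; apply: is_derive_eq; rewrite /GRing.scale /=; ring.
have : f y <= f 0.
  apply: (@ler0_derive1_nincr _ f 0 y) => //.
  - by move=> t /[!in_itv]/= /andP[t0 _]; rewrite derive1E derive_val
      pmulr_rle0 ?expR_gt0// subr_le0; exact: sinh_le (ltW t0).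
  - by apply: derivable_within_continuous => t _; exact: ex_derive.
rewrite /f expr0n mul0r !oppr0 expR0 mul1r expRN mulrC ler_pdivrMr ?expR_gt0//.
lra.
Qed.

Lemma sin_le_id y : 0 <= y -> sin y <= y.
Proof.
move=> y0; pose f (t : R) : R := t - sin t.
have dx (z : R) : is_derive z 1 (fun t : R => t) 1 := is_derive_id z 1.
have df (t : R) : is_derive t 1 f (1 - cos t) by rewrite /f; apply: is_derive_eq.
suff : f 0 <= f y by rewrite /f sin0; lra.
apply: (@ger0_derive1_ndecr _ f 0 y) => //.
- by move=> t _; rewrite derive1E derive_val subr_ge0 cos_le1.
- by apply: derivable_within_continuous => t _; exact: ex_derive.
Qed.

(** The triple angle formula at pi/6 reads (s + 1) (2 s - 1)^2 = 0 for s = sin (pi/6), so s = 1/2;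
    and sin y <= y. *)
Lemma pi_ge3 : 3 <= pi :> R.
Proof.
have pi0 : 0 < pi :> R := pi_gt0 R.
set s : R := sin (pi / 6).
have s1 : 3 * s - 4 * s ^+ 3 = 1.
  rewrite -[RHS](sin_pihalf R) (_ : pi / 2 = pi / 6 + (pi / 6 + pi / 6) :> R); last by field.
  rewrite sinD sinD cosD -/s; have := cos2Dsin2 (pi / 6 : R); rewrite -/s.
  set c := cos _ => h; have {}h : c ^+ 2 = 1 - s ^+ 2 by lra.
  have -> : s * (c * c - s * s) + c * (s * c + c * s) =
            3 * s * c ^+ 2 - s ^+ 3 by ring.
  by rewrite h; ring.
have s0 : 0 < s by rewrite sin_gt0_pi//; lra.
have : (s + 1) * (2 * s - 1) ^+ 2 = 0 by have := s1; lra.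
move/eqP; rewrite mulf_eq0 sqrf_eq0 => /orP[]/eqP s2; first by lra.
by have := @sin_le_id (pi / 6) ltac:(lra); rewrite -/s; lra.
Qed.

End ScalarBounds.

(** * Complex matrices and spectral calculus *)

Section Cplx.
Variable R : realType.
Implicit Types (x y : R) (z w : Cx R).

Fact re_is_zmod_morphism : zmod_morphism (@re R).
Proof. by move=> [a b] [c d]. Qed.
HB.instance Definition _ :=
  GRing.isZmodMorphism.Build (Cx R) R (@re R) re_is_zmod_morphism.

Fact ofR_is_zmod_morphism : zmod_morphism (@ofR R).
Proof. by move=> x y; rewrite /ofR rmorphB. Qed.
Fact ofR_is_monoid_morphism : monoid_morphism (@ofR R).
Proof. by split; [exact: rmorph1|exact: rmorphM]. Qed.
HB.instance Definition _ :=
  GRing.isZmodMorphism.Build R (Cx R) (@ofR R) ofR_is_zmod_morphism.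
HB.instance Definition _ :=
  GRing.isMonoidMorphism.Build R (Cx R) (@ofR R) ofR_is_monoid_morphism.

Definition im z : R := complex.Im z.

Fact im_is_zmod_morphism : zmod_morphism im.
Proof. by move=> [a b] [c d]. Qed.
HB.instance Definition _ :=
  GRing.isZmodMorphism.Build (Cx R) R im im_is_zmod_morphism.

Lemma re_ofR x : re (ofR x) = x. Proof. by []. Qed.
Lemma im_ofR x : im (ofR x) = 0. Proof. by []. Qed.

Lemma reM z w : re (z * w) = re z * re w - im z * im w.
Proof. by case: z w => [a b] [c d]. Qed.

Lemma imM z w : im (z * w) = re z * im w + im z * re w.
Proof. by case: z w => [a b] [c d]. Qed.

Lemma conjE z : z^* = conjc z.
Proof. by []. Qed.

Lemma re_conj z : re z^* = re z.
Proof. by case: z. Qed.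

Lemma im_conj z : im z^* = - im z.
Proof. by case: z. Qed.

Lemma conj_ofR x : (ofR x)^* = ofR x.
Proof. by rewrite conjE /= /conjc oppr0. Qed.

Lemma re_ofRM x z : re (ofR x * z) = x * re z.
Proof. by rewrite reM re_ofR im_ofR mul0r subr0. Qed.

Lemma cx_eqP z w : re z = re w -> im z = im w -> z = w.
Proof. by case: z w => [a b] [c d] /= -> ->. Qed.

Lemma ofR_inj : injective (@ofR R).
Proof. by move=> x y [/= []]. Qed.

Definition nsq z : R := re z ^+ 2 + im z ^+ 2.

Lemma nsq_ge0 z : 0 <= nsq z. Proof. by rewrite addr_ge0 ?sqr_ge0. Qed.

Lemma mulz_conj z : z * z^* = ofR (nsq z).
Proof.
apply: cx_eqP; rewrite ?reM ?imM re_conj im_conj ?re_ofR ?im_ofR /nsq; ring.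
Qed.

Lemma nsq_eq0 z : nsq z = 0 -> z = 0.
Proof.
move/eqP; rewrite paddr_eq0 ?sqr_ge0// !sqrf_eq0 => /andP[/eqP a /eqP b].
exact: cx_eqP.
Qed.

Lemma norm_re_im_lt z x : `|z| < ofR x -> `|re z| < x /\ `|im z| < x.
Proof.
rewrite -[z in `|z|]/(z : R[i]) normc_def => zx.
have {}zx : Num.sqrt (re z ^+ 2 + im z ^+ 2) < x by rewrite -ltcR.
by split; apply: le_lt_trans zx; rewrite -sqrtr_sqr ler_wsqrtr// (lerDl, lerDr) sqr_ge0.
Qed.

Lemma ofR_gt0 x : (0 < ofR x) = (0 < x).
Proof. by rewrite -[0]/(0%:C)%C ltcR. Qed.

End Cplx.

(* Unification of matrix expressions is very slow when it unfolds [Cx R]. *)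
Opaque Cx.

Section Adjoint.
Variable C : numClosedFieldType.

Lemma adjM m n p (A : 'M[C]_(m, n)) (B : 'M[C]_(n, p)) :
  (A *m B)^t* = B^t* *m A^t*.
Proof. by rewrite trmx_mul map_mxM. Qed.

Lemma adjD m n (A B : 'M[C]_(m, n)) : (A + B)^t* = A^t* + B^t*.
Proof. by rewrite linearD /= map_mxD. Qed.

Lemma adjB m n (A B : 'M[C]_(m, n)) : (A - B)^t* = A^t* - B^t*.
Proof. by rewrite linearB /= map_mxB. Qed.

Lemma adjZ m n z (A : 'M[C]_(m, n)) : (z *: A)^t* = z^* *: A^t*.
Proof. by rewrite linearZ /= map_mxZ. Qed.

Lemma adj_scalar n (z : C) : (z%:M : 'M[C]_n)^t* = z^*%:M.
Proof. by rewrite tr_scalar_mx map_scalar_mx. Qed.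

Lemma adjE m n (A : 'M[C]_(m, n)) i j : A^t* i j = (A j i)^*.
Proof. by rewrite !mxE. Qed.

Lemma tr_adj n (A : 'M[C]_n) : \tr (A^t*) = (\tr A)^*.
Proof. by rewrite /mxtrace rmorph_sum; apply: eq_bigr => i _; rewrite adjE. Qed.

Lemma mxtrace_conj2 n (P Q D E : 'M[C]_n) :
  \tr (P^t* *m D *m P *m (Q^t* *m E *m Q)) =
  \tr (D *m (P *m Q^t*) *m E *m (P *m Q^t*)^t*).
Proof.
rewrite adjM trmxCK; move: (P^t*) (Q^t*) => P' Q'.
by rewrite -!mulmxA mxtrace_mulC !mulmxA.
Qed.

End Adjoint.

Section Spectral.
Variable R : realType.
Local Notation C := (Cx R).

(* Sealing [eig] and [specfun] avoids comparing applications of [mxfun] by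
   unfolding, which is prohibitively slow. *)
Fact spectral_key : unit. Proof. exact: tt. Qed.

Definition eig n : 'M[C]_n -> 'I_n -> R :=
  locked_with spectral_key (fun A i => re (spectral_diag A 0 i)).

Definition specfun n : (R -> R) -> 'M[C]_n -> 'M[C]_n :=
  locked_with spectral_key (@mxfun R n).

Lemma specfun_mxfun n : @specfun n = @mxfun R n.
Proof. by rewrite /specfun unlock. Qed.

Lemma eigE n (A : 'M[C]_n) i : eig A i = re (spectral_diag A 0 i).
Proof. by rewrite /eig unlock. Qed.

Definition spdiag n (A : 'M[C]_n) (d : 'rV[C]_n) : 'M[C]_n :=
  (spectralmx A)^t* *m diag_mx d *m spectralmx A.

Lemma specfunE n f (A : 'M[C]_n) :
  specfun f A = spdiag A (\row_i ofR (f (eig A i))).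
Proof.
rewrite specfun_mxfun /mxfun (invmx_unitary (spectral_unitarymx _)).
have -> : \row_i ofR (f (eig A i)) =
    map_mx (fun z => ofR (f (re z))) (spectral_diag A).
  by apply/rowP => i; rewrite !mxE eigE.
by [].
Qed.

Lemma specfun_id n (A : 'M[C]_n) : A^t* = A -> specfun id A = A.
Proof.
move=> hA.
have hermA : A \is hermsymmx by apply/is_hermitianmxP; rewrite expr0 scale1r.
have /orthomx_spectralP AE := hermitian_normalmx hermA.
rewrite [RHS]AE specfun_mxfun /mxfun; set d := map_mx _ _.
have -> : d = spectral_diag A.
  apply/rowP => i; rewrite !mxE.
  have /mxOverP/(_ 0 i)/CrealP := hermitian_spectral_diag_real hermA.
  move=> h; apply: cx_eqP; first by rewrite re_ofR.
  rewrite im_ofR; have := congr1 (@im R) h.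
  by rewrite im_conj => /eqP; rewrite eqNr => /eqP.
by [].
Qed.

Lemma spectral_unitaryl n (A : 'M[C]_n) : spectralmx A *m (spectralmx A)^t* = 1%:M.
Proof. exact/unitarymxP/spectral_unitarymx. Qed.

Lemma spectral_unitaryr n (A : 'M[C]_n) : (spectralmx A)^t* *m spectralmx A = 1%:M.
Proof. exact/mulmx1C/spectral_unitaryl. Qed.

Lemma specfunM n f g (A : 'M[C]_n) :
  specfun f A *m specfun g A = specfun (fun x => f x * g x) A.
Proof.
rewrite !specfunE /spdiag !mulmxA (mulmxtVK _ (spectral_unitarymx _)).
rewrite -[_ *m diag_mx _ *m diag_mx _]mulmxA mulmx_diag.
set d := \row__ _; set e := \row__ _; have -> : d = e; last by [].
by apply/rowP => i; rewrite !mxE rmorphM.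
Qed.

Lemma spdiagD n (A : 'M[C]_n) d e : spdiag A (d + e) = spdiag A d + spdiag A e.
Proof. by rewrite /spdiag linearD mulmxDr mulmxDl. Qed.

Lemma spdiagZ n (A : 'M[C]_n) z d : spdiag A (z *: d) = z *: spdiag A d.
Proof. by rewrite /spdiag linearZ /= -scalemxAr -scalemxAl. Qed.

Lemma specfunD n f g (A : 'M[C]_n) :
  specfun f A + specfun g A = specfun (fun x => f x + g x) A.
Proof.
rewrite !specfunE -spdiagD; congr spdiag.
by apply/rowP => i; rewrite !mxE rmorphD.
Qed.

Lemma specfunZ n a f (A : 'M[C]_n) :
  ofR a *: specfun f A = specfun (fun x => a * f x) A.
Proof.
rewrite !specfunE -spdiagZ; congr spdiag.
by apply/rowP => i; rewrite !mxE rmorphM.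
Qed.

Lemma specfun1 n (A : 'M[C]_n) : specfun (fun=> 1) A = 1%:M.
Proof.
rewrite specfunE /spdiag (_ : \row__ _ = const_mx 1).
  by rewrite diag_const_mx mulmx1 spectral_unitaryr.
by apply/rowP => i; rewrite !mxE rmorph1.
Qed.

Lemma adj_specfun n f (A : 'M[C]_n) : (specfun f A)^t* = specfun f A.
Proof.
rewrite !specfunE /spdiag !adjM trmxCK mulmxA tr_diag_mx map_diag_mx.
set d := \row__ _; have -> : map_mx Num.conj d = d; last by [].
by apply/rowP => i; rewrite !mxE /= conj_ofR.
Qed.

Lemma eq_specfun n f g (A : 'M[C]_n) : f =1 g -> specfun f A = specfun g A.
Proof. by move=> fg; congr specfun; exact/funext. Qed.

Lemma tr_specfun n f (A : 'M[C]_n) : \tr (specfun f A) = ofR (\sum_i f (eig A i)).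
Proof.
rewrite specfunE /spdiag mxtrace_mulC mulmxA spectral_unitaryl mul1mx mxtrace_diag rmorph_sum.
by apply: eq_bigr => i _; rewrite mxE.
Qed.

(** Transition probabilities between the eigenbases of the two matrices. They are the weights with
    which traces of products of spectral functions become double sums over eigenvalues. *)
Definition overlap n : 'M[C]_n -> 'M[C]_n -> 'I_n -> 'I_n -> R :=
  locked_with spectral_key
    (fun A B i j => nsq ((spectralmx A *m (spectralmx B)^t*) i j)).

Lemma overlapE n (A B : 'M[C]_n) i j :
  overlap A B i j = nsq ((spectralmx A *m (spectralmx B)^t*) i j).
Proof. by rewrite /overlap unlock. Qed.

Lemma overlap_ge0 n (A B : 'M[C]_n) i j : 0 <= overlap A B i j.
Proof. by rewrite overlapE nsq_ge0. Qed.

Lemma tr_specfunM n f g (A B : 'M[C]_n) :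
  re (\tr (specfun f A *m specfun g B)) =
  \sum_i \sum_j overlap A B i j * (f (eig A i) * g (eig B j)).
Proof.
rewrite !specfunE /spdiag mxtrace_conj2.
under eq_bigr => i _ do under eq_bigr => j _ do rewrite overlapE.
move: (_ *m _^t*) => W; rewrite /mxtrace raddf_sum; apply: eq_bigr => i _.
rewrite mxE raddf_sum; apply: eq_bigr => j _.
rewrite mul_mx_diag mul_diag_mx adjE !mxE.
set z := W i j; set a := f _; set b := g _.
have -> : ofR a * z * ofR b * z^* = ofR (nsq z * (a * b)).
  by rewrite !(rmorphM (@ofR R)) /= -mulz_conj; ring.
by [].
Qed.

Lemma overlap_suml n (A B : 'M[C]_n) j : \sum_i overlap A B i j = 1.
Proof.
under eq_bigr do rewrite overlapE.
set W := _ *m _.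
have : (W^t* *m W) j j = 1.
  rewrite /W adjM trmxCK mulmxA -[X in X *m _]mulmxA spectral_unitaryr mulmx1.
  by rewrite spectral_unitaryl mxE eqxx.
rewrite mxE => h; apply: ofR_inj; rewrite rmorph1 -h rmorph_sum.
by apply: eq_bigr => i _; rewrite adjE mulrC mulz_conj.
Qed.

End Spectral.

(** * Bipartite vectors as coefficient matrices *)

Section Tensor.
Variable C : numClosedFieldType.

(** With M the coefficient matrix of a ket and M' its adjoint, the reduced states are M M' and the
    transpose of M' M; the Schmidt weights are the squared singular values of M. *)
Definition tensor_mx m n (phi : 'cV[C]_(m * n)) : 'M[C]_(m, n) :=
  \matrix_(i, j) phi (mxvec_index i j) 0.

Definition mx_tensor m n (M : 'M[C]_(m, n)) : 'cV[C]_(m * n) := (mxvec M)^T.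

Lemma tensor_mxK m n : cancel (@tensor_mx m n) (@mx_tensor m n).
Proof.
move=> v; apply/colP => k; rewrite !mxE; case/mxvec_indexP: k => i j.
by rewrite mxvecE mxE.
Qed.

Definition dot n (u v : 'cV[C]_n) : C := (u^t* *m v) 0 0.

Lemma dotE n (u v : 'cV[C]_n) : dot u v = \sum_k (u k 0)^* * v k 0.
Proof. by rewrite /dot mxE; apply: eq_bigr => k _; rewrite adjE. Qed.

Lemma dotDr n (u v w : 'cV[C]_n) : dot u (v + w) = dot u v + dot u w.
Proof. by rewrite /dot mulmxDr mxE. Qed.

Lemma dotZr n (u v : 'cV[C]_n) a : dot u (a *: v) = a * dot u v.
Proof. by rewrite /dot -scalemxAr mxE. Qed.

Lemma dotC n (u v : 'cV[C]_n) : dot u v = (dot v u)^*.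
Proof. by rewrite /dot -adjE adjM trmxCK. Qed.

Lemma dotDl n (u v w : 'cV[C]_n) : dot (u + v) w = dot u w + dot v w.
Proof. by rewrite /dot adjD mulmxDl mxE. Qed.

Lemma dotZl n (u v : 'cV[C]_n) a : dot (a *: u) v = a^* * dot u v.
Proof. by rewrite /dot adjZ -scalemxAl mxE. Qed.

Lemma dotBr n (u v w : 'cV[C]_n) : dot u (v - w) = dot u v - dot u w.
Proof. by rewrite -scaleN1r dotDr dotZr mulN1r. Qed.

Lemma dotBl n (u v w : 'cV[C]_n) : dot (u - v) w = dot u w - dot v w.
Proof. by rewrite -scaleN1r dotDl dotZl rmorphN1 mulN1r. Qed.

Lemma dot_sumr n I (r : seq I) (P : pred I) (F : I -> 'cV[C]_n) u :
  dot u (\sum_(i <- r | P i) F i) = \sum_(i <- r | P i) dot u (F i).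
Proof. by rewrite /dot mulmx_sumr summxE. Qed.

Lemma dotMl m n (A : 'M[C]_(m, n)) u v : dot (A *m u) v = dot u (A^t* *m v).
Proof. by rewrite /dot adjM mulmxA. Qed.

Lemma mxtrace_dot m n (A B : 'M[C]_(m, n)) :
  \tr (B *m A^t*) = dot (mx_tensor A) (mx_tensor B).
Proof.
rewrite dotE (reindex _ (curry_mxvec_bij m n)) /mxtrace /=.
transitivity (\sum_i \sum_j B i j * (A i j)^*).
  by apply: eq_bigr => i _; rewrite mxE; apply: eq_bigr => j _; rewrite adjE.
rewrite pair_bigA; apply: eq_bigr => -[i j] _ /=.
by rewrite mulrC !mxE !mxvecE.
Qed.

Lemma outer_rot m n (M P : 'M[C]_(m, n)) (c s : C) :
  c^* = c -> s^* = s -> c ^+ 2 + s ^+ 2 = 1 ->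
  (c *: M + s *: P) *m (c *: M + s *: P)^t* - M *m M^t* =
  s ^+ 2 *: (P *m P^t* - M *m M^t*) + (c * s) *: (P *m M^t* + (P *m M^t*)^t*).
Proof.
move=> hc hs h; have {}h : c ^+ 2 = 1 - s ^+ 2 by rewrite -h addrK.
rewrite adjM trmxCK adjD !adjZ hc hs mulmxDl !mulmxDr -!scalemxAl -!scalemxAr.
rewrite !scalerA -!expr2 h; apply/matrixP => i j; rewrite !mxE; ring.
Qed.

Lemma mxtrace_herm n (Q X : 'M[C]_n) : Q^t* = Q ->
  \tr (Q *m X^t*) = (\tr (Q *m X))^*.
Proof. by move=> hQ; rewrite -tr_adj adjM hQ mxtrace_mulC. Qed.

Lemma mxtrace_mul_dot m n (Q : 'M[C]_m) (M P : 'M[C]_(m, n)) : Q^t* = Q ->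
  \tr (Q *m (P *m M^t*)) = dot (mx_tensor (Q *m M)) (mx_tensor P).
Proof.
by move=> hQ; rewrite mxtrace_mulC -mulmxA -{1}hQ -adjM mxtrace_dot.
Qed.

Lemma tensor_mxD m n (u v : 'cV[C]_(m * n)) (a b : C) :
  tensor_mx (a *: u + b *: v) = a *: tensor_mx u + b *: tensor_mx v.
Proof. by apply/matrixP => i j; rewrite !mxE. Qed.

End Tensor.

Lemma step_bound (R : realFieldType) (a b d e e' k s t : R) :
  e' <= e + (s * (b - a) + t * (d + d)) -> `|a| <= k -> `|b| <= k -> 0 <= s ->
  e' <= e + 2 * t * d + 2 * k * s.
Proof.
rewrite !ler_norml => h /andP[h1 h2] /andP[h3 h4] s0.
have : s * (b - a) <= s * (2 * k) by rewrite ler_wpM2l//; lra.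
lra.
Qed.

(** * Truncated entropy of the reduced state *)

Section Rdm.
Variables (R : realType) (m n : nat).
Local Notation C := (Cx R).
Implicit Types (phi psi : 'cV[C]_(m * n)) (N : nat).

Definition rdm phi : 'M[C]_m := ptrace2 (ketbra phi).

Lemma rdmE phi : rdm phi = tensor_mx phi *m (tensor_mx phi)^t*.
Proof.
apply/matrixP => i k; rewrite /rdm /ptrace2 /ketbra !mxE.
by apply: eq_bigr => j _; rewrite adjE !mxE big_ord1 adjE.
Qed.

Lemma adj_rdm phi : (rdm phi)^t* = rdm phi.
Proof. by rewrite rdmE adjM trmxCK. Qed.

Lemma dot_unit p (u : 'cV[C]_p) : unit_vector u -> dot u u = 1.
Proof. by rewrite /unit_vector /dot => ->; rewrite mxE eqxx. Qed.

Lemma unit_dot p (u : 'cV[C]_p) : dot u u = 1 -> unit_vector u.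
Proof. by move=> h; apply/matrixP => i j; rewrite !ord1 [RHS]mxE eqxx. Qed.

Lemma tr_rdm phi : \tr (rdm phi) = dot phi phi.
Proof. by rewrite rdmE mxtrace_dot !tensor_mxK. Qed.

Lemma sum_eig p (A : 'M[C]_p) : A^t* = A -> \sum_i eig A i = re (\tr A).
Proof. by move=> /specfun_id {2}<-; rewrite tr_specfun re_ofR. Qed.

Lemma sum_eig_rdm phi : unit_vector phi -> \sum_i eig (rdm phi) i = 1.
Proof. by move=> h; rewrite sum_eig ?adj_rdm// tr_rdm dot_unit. Qed.

Lemma spectral_diagE p (A : 'M[C]_p) : A^t* = A ->
  spectralmx A *m A *m (spectralmx A)^t* = diag_mx (\row_i ofR (eig A i)).
Proof.
move=> hA; rewrite -{2}(specfun_id hA) specfunE /spdiag.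
set P := spectralmx A; rewrite !mulmxA /P spectral_unitaryl mul1mx.
by rewrite -mulmxA spectral_unitaryl mulmx1.
Qed.

Lemma eig_diag p (A : 'M[C]_p) i : A^t* = A ->
  ofR (eig A i) = (spectralmx A *m A *m (spectralmx A)^t*) i i.
Proof. by move=> hA; rewrite spectral_diagE// !mxE eqxx mulr1n. Qed.

Lemma eig_rdm_ge0 phi i : 0 <= eig (rdm phi) i.
Proof.
have := eig_diag i (adj_rdm phi); rewrite {3}rdmE.
move: (spectralmx _) (tensor_mx phi) => P M.
rewrite mulmxA -mulmxA -adjM mxE => h; rewrite -[leRHS]re_ofR h raddf_sum.
by apply: sumr_ge0 => j _ /=; rewrite adjE mulz_conj re_ofR nsq_ge0.
Qed.

Lemma eig_rdm_le1 phi i : unit_vector phi -> eig (rdm phi) i <= 1.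
Proof.
move=> /sum_eig_rdm <-; rewrite (bigD1 i)//= lerDl sumr_ge0// => j _.
exact: eig_rdm_ge0.
Qed.

(** [S] selects the coordinates with nonzero eigenvalue. Compressing the diagonalized matrix by it
    yields an invertible diagonal matrix, and compression cannot raise the rank. *)
Lemma rank_eig p (A : 'M[C]_p) : A^t* = A ->
  (#|[pred i | eig A i != 0%R]| <= \rank A)%N.
Proof.
move=> hA; pose f (i : 'I_#|[pred i | eig A i != 0%R]|) := enum_val i.
pose S : 'M[C]_(#|[pred i | eig A i != 0%R]|, p) := \matrix_(i, j) (f i == j)%:R.
have SE q (B : 'M[C]_(p, q)) i j : (S *m B) i j = B (f i) j.
  rewrite mxE (bigD1 (f i))//= mxE eqxx mul1r big1 ?addr0// => k kf.
  by rewrite mxE eq_sym (negPf kf) mul0r.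
set P := spectralmx A.
have : S *m (P *m A *m P^t*) *m S^T = diag_mx (\row_i ofR (eig A (f i))).
  rewrite /P spectral_diagE//.
  apply/matrixP => i j; rewrite -mulmxA SE mul_diag_mx !mxE.
  have -> : (f j == f i) = (i == j) by rewrite eq_sym (inj_eq enum_val_inj).
  by case: eqP; rewrite ?mulr1 ?mulr0.
move/(congr1 mxrank); rewrite [RHS]mxrank_unit; last first.
  rewrite unitmxE det_diag unitfE prodf_seq_neq0; apply/allP => i _ /=.
  rewrite mxE; have := enum_valP i; rewrite inE => h.
  by apply: contra h => /eqP h; apply/eqP/ofR_inj; rewrite h rmorph0.
move=> {1}<-; apply: leq_trans (mxrankM_maxl _ _) _.
apply: leq_trans (mxrankM_maxr _ _) _; apply: leq_trans (mxrankM_maxl _ _) _.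
exact: mxrankM_maxr.
Qed.

(** All traces involved are averages with the same weights [overlap A B i j], so the scalar tangent
    inequality at each pair of eigenvalues suffices, although [A] and [B] need not commute. *)
Lemma klein (f g : R -> R) p (A B : 'M[C]_p) : A^t* = A -> B^t* = B ->
  (forall i j, f (eig B j) <= f (eig A i) + (eig B j - eig A i) * g (eig A i)) ->
  \sum_j f (eig B j) <=
  \sum_i f (eig A i) + re (\tr (specfun g A *m (B - A))).
Proof.
move=> hA hB fg.
(* The functions x g(x), 1 and x become variables tied to [g] only by pointwise equations, so that
   each trace below has the shape required by [tr_specfunM]. *)
suff main (h o k : R -> R) : (forall x, g x * k x = h x) -> (forall x, o x = 1) ->
    (forall x, k x = x) -> \sum_j f (eig B j) <=
    \sum_i f (eig A i) + re (\tr (specfun g A *m (B - A))).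
  by apply: (main (fun x => g x * x) (fun=> 1) id).
move=> hE oE kE.
have kid (M : 'M[C]_p) : M^t* = M -> specfun k M = M.
  by move=> hM; rewrite (eq_specfun _ kE) specfun_id.
have oid (M : 'M[C]_p) : specfun o M = 1%:M by rewrite (eq_specfun _ oE) specfun1.
have eA : \sum_i f (eig A i) =
    \sum_i \sum_j overlap A B i j * (f (eig A i) * o (eig B j)).
  by rewrite -tr_specfunM oid mulmx1 tr_specfun re_ofR.
have eB : \sum_i f (eig B i) =
    \sum_i \sum_j overlap A B i j * (o (eig A i) * f (eig B j)).
  by rewrite -tr_specfunM oid mul1mx tr_specfun re_ofR.
have eC : re (\tr (specfun g A *m A)) =
    \sum_i \sum_j overlap A B i j * (h (eig A i) * o (eig B j)).
  by rewrite -tr_specfunM oid mulmx1 -(eq_specfun _ hE) -specfunM kid.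
have eD : re (\tr (specfun g A *m B)) =
    \sum_i \sum_j overlap A B i j * (g (eig A i) * k (eig B j)).
  by rewrite -tr_specfunM kid.
have -> : re (\tr (specfun g A *m (B - A))) =
    \sum_i \sum_j overlap A B i j * (g (eig A i) * k (eig B j)) -
    \sum_i \sum_j overlap A B i j * (h (eig A i) * o (eig B j)).
  by rewrite -eC -eD mulmxBr (raddfB mxtrace) (raddfB (@re R)).
rewrite eA eB -sumrB -big_split /=; apply: ler_sum => i _.
rewrite -sumrB -big_split /=; apply: ler_sum => j _.
rewrite -mulrBr -mulrDr ler_wpM2l ?overlap_ge0// -hE !oE !kE.
by move: (fg i j); clear; lra.
Qed.

Definition entN N phi : R := \sum_i eta N (eig (rdm phi) i).

Definition entgrad N phi : 'cV[C]_(m * n) :=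
  mx_tensor (specfun (deta N) (rdm phi) *m tensor_mx phi).

Definition nsqv p (v : 'cV[C]_p) : R := \sum_k nsq (v k 0).

Lemma dot_nsqv p (v : 'cV[C]_p) : dot v v = ofR (nsqv v).
Proof.
rewrite dotE (rmorph_sum (@ofR R)); apply: eq_bigr => k _.
by rewrite mulrC mulz_conj.
Qed.

Lemma nsqv_entgrad N phi : nsqv (entgrad N phi) =
  \sum_i eig (rdm phi) i * deta N (eig (rdm phi) i) ^+ 2.
Proof.
apply: ofR_inj; rewrite -dot_nsqv /entgrad -mxtrace_dot adjM mulmxA.
rewrite -[X in X *m _]mulmxA -rdmE adj_specfun -{2}(specfun_id (adj_rdm phi)).
rewrite !specfunM tr_specfun; congr ofR; apply: eq_bigr => i _; ring.
Qed.

Lemma tr_specfun_rdm_le N phi psi : unit_vector phi -> unit_vector psi ->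
  `|re (\tr (specfun (deta N) (rdm phi) *m rdm psi))| <= N.+1%:R.
Proof.
move=> uphi upsi.
have -> : re (\tr (specfun (deta N) (rdm phi) *m rdm psi)) =
    re (\tr (specfun (deta N) (rdm phi) *m specfun id (rdm psi))).
  by rewrite (specfun_id (adj_rdm psi)).
rewrite tr_specfunM; apply: le_trans (ler_norm_sum _ _ _) _.
apply: (@le_trans _ _ (\sum_i \sum_j overlap (rdm phi) (rdm psi) i j *
    (N.+1%:R * eig (rdm psi) j))).
  apply: ler_sum => i _; apply: le_trans (ler_norm_sum _ _ _) _.
  apply: ler_sum => j _; rewrite !normrM (ger0_norm (overlap_ge0 _ _ _ _)).
  rewrite ler_wpM2l ?overlap_ge0// (ger0_norm (eig_rdm_ge0 psi j)).
  by rewrite ler_wpM2r ?eig_rdm_ge0// deta_norm_le ?eig_rdm_ge0// eig_rdm_le1.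
rewrite exchange_big /=.
under eq_bigr => j _ do rewrite -mulr_suml overlap_suml mul1r.
by rewrite -mulr_sumr sum_eig_rdm// mulr1.
Qed.

(** Concavity makes the first-order expansion an upper bound, so no second derivative of the entropy
    occurs. The quadratic term stems only from the reduced state itself, whose change under the
    rotation is given exactly by [outer_rot]. *)
Lemma entN_step N phi psi (c s : R) (chi := ofR c *: phi + ofR s *: psi) :
  unit_vector phi -> unit_vector psi -> unit_vector chi -> c ^+ 2 + s ^+ 2 = 1 ->
  entN N chi <= entN N phi + 2 * (c * s) * re (dot (entgrad N phi) psi)
    + 2 * N.+1%:R * s ^+ 2.
Proof.
move=> uphi upsi uchi cs.
set Q := specfun (deta N) (rdm phi).
have : entN N chi <= entN N phi + re (\tr (Q *m (rdm chi - rdm phi))).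
  apply: klein (adj_rdm phi) (adj_rdm chi) _ => i j.
  exact: eta_tangent (eig_rdm_le1 i uphi) (eig_rdm_le1 j uchi).
set M := tensor_mx phi; set P := tensor_mx psi.
have -> : rdm chi - rdm phi = ofR (s ^+ 2) *: (rdm psi - rdm phi) +
   ofR (c * s) *: (P *m M^t* + (P *m M^t*)^t*).
  rewrite [rdm chi]rdmE tensor_mxD !rdmE (rmorphXn (@ofR R)) (rmorphM (@ofR R)).
  by apply: outer_rot; rewrite ?conj_ofR// -!rmorphXn -rmorphD cs rmorph1.
have retr a b (X Y : 'M[C]_m) : re (\tr (Q *m (ofR a *: X + ofR b *: Y))) =
    a * re (\tr (Q *m X)) + b * re (\tr (Q *m Y)).
  rewrite mulmxDr -!scalemxAr mxtraceD !mxtraceZ raddfD /=.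
  by rewrite !re_ofRM.
have retrD (X Y : 'M[C]_m) : re (\tr (X + Y)) = re (\tr X) + re (\tr Y).
  by rewrite mxtraceD (raddfD (@re R)).
have retrB (X Y : 'M[C]_m) : re (\tr (X - Y)) = re (\tr X) - re (\tr Y).
  by rewrite (raddfB mxtrace) (raddfB (@re R)).
rewrite retr mulmxDr retrD mulmxBr retrB.
have hQ : Q^t* = Q := adj_specfun _ _.
rewrite (mxtrace_herm _ hQ) re_conj (mxtrace_mul_dot _ _ hQ) tensor_mxK.
rewrite -[mx_tensor _]/(entgrad N phi).
move/step_bound; apply; rewrite ?sqr_ge0 ?tr_specfun_rdm_le//.
Qed.

End Rdm.

Section Entropy.
Variables (R : realType) (m n : nat).
Local Notation C := (Cx R).
Implicit Types (phi psi : 'cV[C]_(m * n)) (N : nat).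

Definition mxpow p (A : 'M[C]_p) k := iter k (mulmx A) 1%:M.

Lemma specfun_pow p (A : 'M[C]_p) (a : R) k : A^t* = A ->
  specfun (fun x => (1 - a * x) ^+ k) A = mxpow (1%:M - ofR a *: A) k.
Proof.
move=> hA; elim: k => [|k IH] /=.
  by rewrite (eq_specfun (g := fun=> 1)) ?specfun1// => x; rewrite expr0.
rewrite -IH.
have {1}-> : 1%:M - ofR a *: A = specfun (fun x => 1 - a * x) A.
  rewrite (@eq_specfun _ _ _ (fun x => 1 + (- a) * id x)) => [|x]; last by rewrite mulNr.
  by rewrite -(specfunD (fun=> 1)) specfun1 -specfunZ specfun_id// rmorphN scaleNr.
by rewrite specfunM; apply: eq_specfun => x; rewrite exprS.
Qed.

(* Measurability of the entropy comes from this polynomial in the entries of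
   [A]; the measurability of the eigenvalues is never needed. *)
Definition eta_poly N (a : R) p (A : 'M[C]_p) : R :=
  re (\tr (mxpow (1%:M - ofR a *: A) 1)) -
  \sum_(k < N) re (\tr (mxpow (1%:M - ofR a *: A) k.+2)) / (k.+1%:R * k.+2%:R).

Lemma eta_polyE N a p (A : 'M[C]_p) : A^t* = A ->
  eta_poly N a A = \sum_i eta N (a * eig A i).
Proof.
move=> hA.
have trE k : re (\tr (mxpow (1%:M - ofR a *: A) k)) =
    \sum_i (1 - a * eig A i) ^+ k by rewrite -specfun_pow// tr_specfun re_ofR.
rewrite /eta_poly trE /eta [RHS]sumrB.
have -> : \sum_i \sum_(k < N) (1 - a * eig A i) ^+ k.+2 / (k.+1%:R * k.+2%:R) =
    \sum_(k < N) re (\tr (mxpow (1%:M - ofR a *: A) k.+2)) / (k.+1%:R * k.+2%:R).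
  by rewrite exchange_big; apply: eq_bigr => k _; rewrite trE mulr_suml.
by under eq_bigr do rewrite expr1.
Qed.

Lemma entN_poly N phi : entN N phi = eta_poly N 1 (rdm phi).
Proof.
by rewrite eta_polyE ?adj_rdm//; apply: eq_bigr => i _; rewrite mul1r.
Qed.

Lemma ent_entropyE phi : ln 2 * ent_entropy phi =
  \sum_i - (eig (rdm phi) i * ln (eig (rdm phi) i)).
Proof.
have ln2 : ln 2 != 0 :> R by rewrite gt_eqF// ln_gt0// ltr1n.
rewrite /ent_entropy /vN_entropy -/(rdm phi) -specfun_mxfun.
rewrite -{1}(specfun_id (adj_rdm phi)) specfunM tr_specfun re_ofR.
rewrite mulrN mulr_sumr sumrN; congr (- _); apply: eq_bigr => i _.
by rewrite /log2; field.
Qed.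

Lemma purityE p (A : 'M[C]_p) : A^t* = A -> purity A = \sum_i eig A i ^+ 2.
Proof.
move=> hA; rewrite /purity -{1 2}(specfun_id hA) specfunM tr_specfun re_ofR.
by apply: eq_bigr => i _; rewrite expr2.
Qed.

Lemma ent_entropy_le_entN N phi : unit_vector phi ->
  ln 2 * ent_entropy phi <= entN N phi.
Proof.
move=> u; rewrite ent_entropyE; apply: ler_sum => i _.
by rewrite eta_ge ?eig_rdm_ge0 ?eig_rdm_le1.
Qed.

Lemma entN_le_ent_entropy N phi : unit_vector phi ->
  entN N phi <= ln 2 * ent_entropy phi + m%:R / N.+1%:R.
Proof.
move=> u; rewrite ent_entropyE.
have -> : m%:R / N.+1%:R = \sum_(i < m) N.+1%:R^-1 :> R.
  by rewrite sumr_const card_ord -[RHS]mulr_natl.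
rewrite -big_split /=; apply: ler_sum => i _.
by rewrite eta_le ?eig_rdm_ge0 ?eig_rdm_le1.
Qed.

(** The tangent of - ln at [c], averaged with the eigenvalues as weights. The bound is affine in the
    purity, so its expectation involves only the mean purity. *)
Lemma ent_entropy_ge_purity phi (c : R) : unit_vector phi -> 0 < c ->
  1 - ln c - purity (rdm phi) / c <= ln 2 * ent_entropy phi.
Proof.
move=> u c0; rewrite ent_entropyE purityE ?adj_rdm//.
have -> : 1 - ln c - (\sum_i eig (rdm phi) i ^+ 2) / c =
  \sum_i (eig (rdm phi) i * (1 - ln c) - eig (rdm phi) i ^+ 2 / c).
  by rewrite sumrB -!mulr_suml sum_eig_rdm// mul1r.
apply: ler_sum => i _; set x := eig _ i.
have : 0 <= x := eig_rdm_ge0 phi i.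
rewrite le_eqVlt => /predU1P[<-|x0]; first by rewrite expr0n !mul0r subr0 oppr0.
have h : ln x - ln c <= x / c - 1.
  rewrite -ln_div ?posrE//.
  rewrite -{1}[x / c](subrKC 1); apply: le_ln1Dx.
  by rewrite ltrBrDl subrr divr_gt0.
have := ler_wpM2l (ltW x0) h; rewrite !mulrBr mulrA -expr2 !mulr1.
by move: (x * ln x) (x * ln c) (_ / c) => a b d; lra.
Qed.

(* Rescaling by [t], the squared norm of [phi], brings the eigenvalues in [0, 1]. *)
Lemma ent_entropy_approx N phi (t := re (\tr (rdm phi))) :
  `|ln 2 * ent_entropy phi -
    (- (t * ln t) + t * eta_poly N (expR (- ln t)) (rdm phi))| <=
  t * m%:R / N.+1%:R.
Proof.
rewrite eta_polyE ?adj_rdm// ent_entropyE.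
have tE : \sum_i eig (rdm phi) i = t by rewrite sum_eig// adj_rdm.
have x0 i : 0 <= eig (rdm phi) i := eig_rdm_ge0 phi i.
have xt i : eig (rdm phi) i <= t.
  by rewrite -tE (bigD1 i)//= lerDl sumr_ge0.
have : 0 <= t by rewrite -tE sumr_ge0.
rewrite le_eqVlt => /predU1P[t0|t0].
  rewrite -t0 !mul0r oppr0 addr0 subr0 big1 ?normr0// => i _.
  have -> : eig (rdm phi) i = 0 by apply/eqP; rewrite eq_le x0 andbT t0.
  by rewrite mul0r oppr0.
rewrite expRN lnK ?posrE//.
have -> : - (t * ln t) = - \sum_i (eig (rdm phi) i * ln t).
  by rewrite -mulr_suml tE.
have -> : t * m%:R / N.+1%:R = \sum_(i < m) t / N.+1%:R.
  by rewrite sumr_const card_ord -[RHS]mulr_natl mulrCA mulrA.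
rewrite mulr_sumr opprD opprK addrA -!big_split /= -sumrB.
apply: le_trans (ler_norm_sum _ _ _) (ler_sum _ _) => i _.
set x := eig _ i; have xa : 0 <= x / t by rewrite divr_ge0 ?x0// ltW.
have xb : x / t <= 1 by rewrite ler_pdivrMr// mul1r xt.
have {1 3}-> : x = t * (x / t) by rewrite mulrCA divff ?mulr1// gt_eqF.
have {xa xb} := (eta_ge N xa xb, eta_le N xa xb).
have lnE : x / t * ln x = x / t * ln (x / t) + x / t * ln t.
  have : 0 <= x := x0 i; rewrite le_eqVlt => /predU1P[<-|xp].
    by rewrite !mul0r addr0.
  by rewrite ln_div ?posrE//; ring.
rewrite -[_ * x]mulrC; set y := x / t in lnE * => -[h1 h2].
have -> : - (t * y * ln x) + t * y * ln t - t * eta N y =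
  t * (- (y * ln y) - eta N y) by rewrite -!(mulrA t) lnE; ring.
rewrite normrM (gtr0_norm t0) ler_pM2l// ler_norml.
by apply/andP; split; move: h1 h2; set z := _^-1 => h1 h2; lra.
Qed.

Lemma max_rank_ge (K : {vspace 'cV[C]_(m * n)}) phi :
  phi \in K -> unit_vector phi -> (\rank (rdm phi) <= max_rank K)%N.
Proof.
move=> pK u; have rm : (\rank (rdm phi) < m.+1)%N by rewrite ltnS rank_leq_row.
rewrite /max_rank.
apply: (@leq_bigmax_cond _ _ (fun r : 'I_m.+1 => nat_of_ord r) (Ordinal rm)).
by apply/asboolP; exists phi.
Qed.

Lemma max_rank_gt0 (K : {vspace 'cV[C]_(m * n)}) phi :
  phi \in K -> unit_vector phi -> (0 < max_rank K)%N.
Proof.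
move=> pK u; apply: leq_trans (max_rank_ge pK u).
rewrite lt0n mxrank_eq0; apply/eqP => r0.
have := tr_rdm phi; rewrite r0 mxtrace0 dot_unit// => /eqP.
by rewrite eq_sym oner_eq0.
Qed.

Lemma nsqv_entgrad_le N (K : {vspace 'cV[C]_(m * n)}) phi :
  phi \in K -> unit_vector phi ->
  nsqv (entgrad N phi) <= 3 + 4 * ln (max_rank K)%:R ^+ 2.
Proof.
move=> pK u; rewrite nsqv_entgrad; apply: sum_deta_sqr_le.
- exact: max_rank_gt0 pK u.
- exact: eig_rdm_ge0.
- exact: sum_eig_rdm.
- apply: leq_trans (rank_eig (adj_rdm phi)) _; exact: max_rank_ge.
Qed.

End Entropy.

(** * Unitaries that carry one unit vector to another *)

Section Householder.
Variable C : numClosedFieldType.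

Lemma dot_eq0 n (v : 'cV[C]_n) : dot v v = 0 -> v = 0.
Proof.
rewrite dotE => /eqP; rewrite psumr_eq0 => [/allP h|k _]; last first.
  by rewrite mulrC mul_conjC_ge0.
apply/colP => k; rewrite mxE; have := h k (mem_index_enum k).
by rewrite mulrC mul_conjC_eq0 => /eqP.
Qed.

(** The usual reflection along v = x - y divides by half of <v, v> and maps x to y only if <x, y> is
    real. Dividing by <v, x>, whose real part is half of <v, v>, absorbs the phase: the map takes x
    to y for distinct unit vectors and stays unitary because <v, v> is <v, x> plus its conjugate. *)
Definition householder n (x y : 'cV[C]_n) : 'M[C]_n :=
  1%:M - (dot (x - y) x)^-1 *: ((x - y) *m (x - y)^t*).

Lemma mulmx_outer n (u v w : 'cV[C]_n) : u *m v^t* *m w = dot v w *: u.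
Proof.
rewrite -mulmxA (mx11_scalar (v^t* *m w)) -/(dot v w).
by rewrite mul_mx_scalar.
Qed.

Lemma householderE n (x y z : 'cV[C]_n) :
  householder x y *m z = z - (dot (x - y) x)^-1 * dot (x - y) z *: (x - y).
Proof. by rewrite /householder mulmxBl mul1mx -scalemxAl mulmx_outer scalerA. Qed.

Lemma householder_neq0 n (x y : 'cV[C]_n) : dot x x = 1 -> dot y y = 1 ->
  x != y -> dot (x - y) x != 0.
Proof.
move=> hx hy; apply: contra; rewrite dotBl hx subr_eq0 => /eqP yx.
have xy : dot x y = 1 by rewrite dotC -yx rmorph1.
rewrite -subr_eq0; apply/eqP/dot_eq0.
by rewrite dotBl !dotBr hx hy -yx xy !subrr.
Qed.

Lemma householder_map n (x y : 'cV[C]_n) : dot x x = 1 -> dot y y = 1 ->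
  x != y -> householder x y *m x = y.
Proof.
move=> hx hy xy; rewrite householderE mulVf ?householder_neq0//.
by rewrite scale1r subKr.
Qed.

Lemma householder_unitary n (x y : 'cV[C]_n) : dot x x = 1 -> dot y y = 1 ->
  x != y -> householder x y *m (householder x y)^t* = 1%:M.
Proof.
move=> hx hy xy; have a0 := householder_neq0 hx hy xy.
have vv : dot (x - y) (x - y) = dot (x - y) x + (dot (x - y) x)^*.
  rewrite -[(dot _ x)^*]dotC !dotBl !dotBr hx hy; ring.
rewrite /householder; set a := dot _ x in a0 vv *; move: (x - y) vv => v vv.
rewrite adjB adjZ adj_scalar conjC1 adjM trmxCK.
rewrite mulmxBl mul1mx mulmxBr mulmx1 -scalemxAl -scalemxAr scalerA.
rewrite mulmxA mulmx_outer -scalemxAl vv scalerA.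
move: (v *m v^t*) => X; rewrite fmorphV /=.
have : a^* != 0 by rewrite conjC_eq0.
move: (a^*) => b b0; apply/matrixP => i j; rewrite !mxE; field.
by rewrite a0 b0.
Qed.

End Householder.

(** * The unitary group of a subspace and its Haar measure *)

Section UnitaryGroup.
Variables (R : realType) (n : nat) (K : {vspace 'cV[Cx R]_n}).
Local Notation C := (Cx R).
Local Notation G := (unitary_group K).
Local Notation Pi := (orthoproj K).

Lemma unitary_groupP U : G U <->
  U *m U^t* = 1%:M /\ U *m (1%:M - Pi) = 1%:M - Pi.
Proof. by split=> -[/unitarymxP]. Qed.

Lemma unitary_group1 : G 1%:M.
Proof. by apply/unitary_groupP; rewrite adj_scalar conjC1 !mul1mx. Qed.

Lemma unitary_groupl U : G U -> U^t* *m U = 1%:M.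
Proof. by case/unitary_groupP => /mulmx1C. Qed.

Lemma unitary_groupM U V : G U -> G V -> G (U *m V).
Proof.
move=> /unitary_groupP[uU fU] /unitary_groupP[uV fV]; apply/unitary_groupP.
by rewrite adjM mulmxA -(mulmxA U) uV mulmx1 -mulmxA fV.
Qed.

Lemma unitary_groupV U : G U -> G (U^t*).
Proof.
move=> gU; have uU := unitary_groupl gU; case/unitary_groupP: gU => _ fU.
by apply/unitary_groupP; rewrite trmxCK uU -[X in _ *m X]fU mulmxA uU mul1mx.
Qed.

Lemma unitary_group_dot U u v : G U -> dot (U *m u) (U *m v) = dot u v.
Proof. by move=> gU; rewrite dotMl mulmxA unitary_groupl// mul1mx. Qed.

Lemma orthoproj_adj : Pi^t* = Pi. Proof. by case: (orthoprojP K). Qed.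

Lemma mem_orthoproj v : (v \in K) <-> Pi *m v = v.
Proof.
have [_ _ inK idK] := orthoprojP K.
by split=> [/idK//|<-].
Qed.

Lemma unitary_group_compl U : G U -> (1%:M - Pi) *m U = 1%:M - Pi.
Proof.
move=> /unitary_groupV/unitary_groupP[_ /(congr1 (fun M => M^t*))].
by rewrite adjM trmxCK adjB orthoproj_adj adj_scalar conjC1.
Qed.

Lemma unitary_group_mem U v : G U -> v \in K -> U *m v \in K.
Proof.
move=> gU /mem_orthoproj vK; apply/mem_orthoproj.
have : (1%:M - Pi) *m (U *m v) = 0.
  by rewrite mulmxA unitary_group_compl// mulmxBl mul1mx vK subrr.
by rewrite mulmxBl mul1mx => /eqP; rewrite subr_eq0 => /eqP.
Qed.

Lemma unitary_group_conj U : G U -> U *m Pi *m U^t* = Pi.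
Proof.
move=> gU; have [uU fU] := (unitary_groupP U).1 gU.
have : U *m (1%:M - Pi) *m U^t* = 1%:M - Pi.
  by rewrite fU unitary_group_compl//; exact: unitary_groupV.
rewrite mulmxBr mulmx1 mulmxBl uU => /eqP.
by rewrite (inj_eq (addrI _)) => /eqP/oppr_inj.
Qed.

(** The Householder map fixes everything orthogonal to x - y. Hence it acts trivially off [K], and
    it fixes every vector orthogonal to both x and y; the latter allows one vector of an orthogonal
    pair to be moved while the other stays. *)
Lemma unitary_group_trans x y : x \in K -> y \in K -> dot x x = 1 -> dot y y = 1 ->
  exists W, [/\ G W, W *m x = y &
    forall z, dot x z = 0 -> dot y z = 0 -> W *m z = z].
Proof.
move=> /mem_orthoproj xK /mem_orthoproj yK hx hy.
have [->|xy] := eqVneq x y.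
  by exists 1%:M; split=> [||z _ _]; rewrite ?mul1mx//; exact: unitary_group1.
exists (householder x y); split.
- apply/unitary_groupP; split; first exact: householder_unitary.
  rewrite /householder mulmxBl mul1mx -scalemxAl -mulmxA.
  have -> : (x - y)^t* *m (1%:M - Pi) = 0.
    rewrite -[1%:M - Pi]trmxCK -adjM adjB orthoproj_adj adj_scalar conjC1.
    by rewrite mulmxBl mul1mx mulmxBr xK yK subrr trmx0 map_mx0.
  by rewrite mulmx0 scaler0 subr0.
- exact: householder_map.
- by move=> z xz yz; rewrite householderE (dotBl x y z) xz yz subrr mulr0 scale0r subr0.
Qed.

Lemma orthonormal_basis : exists e : 'I_(\dim K) -> 'cV[C]_n,
  [/\ forall i, e i \in K, forall i j, dot (e i) (e j) = (i == j)%:R &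
      \sum_i e i *m (e i)^t* = Pi].
Proof.
set B := \matrix_(i < \dim K) ((vbasis K)`_i)^T.
have freeB : row_free B.
  apply: inj_row_free => u /(congr1 trmx); rewrite trmx0 mulmx_sum_row linear_sum /=.
  have /freeP := basis_free (vbasisP K) => fr uB.
  apply/rowP => i; rewrite mxE; apply: (fr (fun i => u 0 i)).
  rewrite -[RHS]uB; apply: eq_bigr => j _; by rewrite linearZ rowK /= trmxK.
have dn : (\dim K <= n)%N by rewrite -(eqP freeB) rank_leq_col.
set S := schmidt B; have SB : (S :=: B)%MS := eqmx_schmidt_free freeB.
have SS : S *m S^t* = 1%:M by apply/unitarymxP/schmidt_unitarymx.
set P := proj_ortho B; have PiE : Pi = P^T by [].
have SP : S *m P = S by rewrite proj_ortho_id// SB.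
have P_herm : P^t* = P.
  have := orthoproj_adj; rewrite PiE trmxK => h.
  by rewrite -h; apply/matrixP => i j; rewrite !mxE conjCK.
(* [P] factors through [S], so multiplying it on the right by the Gram projection of [S] changes
   nothing. The adjoint of this identity together with [S *m P = S] identifies the two
   projections. *)
have PE : S^t* *m S = P.
  have /submxP[X PX] : (P <= S)%MS by rewrite SB -[P]mul1mx proj_ortho_sub.
  have h1 : P *m (S^t* *m S) = P by rewrite {1}PX mulmxA -(mulmxA X) SS mulmx1 -PX.
  have : (P *m (S^t* *m S))^t* = P^t* by rewrite h1.
  by rewrite 2!adjM trmxCK P_herm -mulmxA SP.
exists (fun i => (row i S)^T); split=> [i|i j|].
- by apply/mem_orthoproj; rewrite PiE -trmx_mul -row_mul SP.
- have /matrixP/(_ j i) := SS; rewrite !mxE eq_sym => <-.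
  by rewrite dotE; apply: eq_bigr => k _; rewrite !mxE mulrC.
- rewrite PiE -PE; apply/matrixP => i j; rewrite summxE !mxE.
  by apply: eq_bigr => k _; rewrite !mxE big_ord1 !mxE mulrC.
Qed.

Lemma dim_gt0 a : a \in K -> dot a a = 1 -> (0 < \dim K)%N.
Proof.
move=> aK ha; rewrite lt0n dimv_eq0; apply/eqP => K0.
move: aK; rewrite K0 memv0 => /eqP a0; move/eqP: ha.
by rewrite a0 /dot mulmx0 mxE eq_sym oner_eq0.
Qed.

(** Instead of completing [a], an arbitrary orthonormal basis is moved by a unitary that takes one
    of its members to [a]. *)
Lemma orthonormal_basis_from a : a \in K -> dot a a = 1 ->
  exists e : 'I_(\dim K) -> 'cV[C]_n, exists i0,
  [/\ forall i, e i \in K, forall i j, dot (e i) (e j) = (i == j)%:R & e i0 = a].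
Proof.
move=> aK ha; have [e [eK ee _]] := orthonormal_basis.
pose i0 := Ordinal (dim_gt0 aK ha).
have ei0 : dot (e i0) (e i0) = 1 by rewrite ee eqxx.
have [W [gW We _]] := unitary_group_trans (eK i0) aK ei0 ha.
exists (fun i => W *m e i), i0; split=> // [i|i j].
- exact: unitary_group_mem.
- by rewrite unitary_group_dot.
Qed.

End UnitaryGroup.

(** * Measurability of matrix-valued maps *)

Section MeasurableMatrix.
Variable R : realType.
Local Notation C := (Cx R).

(** Working with real and imaginary parts reduces every measurability question to real-valued
    functions, where sums and products are available. *)
Definition cx_measurable d (T : measurableType d) (f : T -> C) : Prop :=
  measurable_fun setT (fun t => re (f t)) /\ measurable_fun setT (fun t => im (f t)).

Definition mx_measurable d (T : measurableType d) p q (Z : T -> 'M[C]_(p, q)) :=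
  forall i j, cx_measurable (fun t => Z t i j).

Section Calculus.
Variables (d : measure_display) (T : measurableType d).
Implicit Types (f g : T -> C).

Lemma cx_measurable_cst z : cx_measurable (fun _ : T => z).
Proof. by split; exact: measurable_cst. Qed.

Lemma cx_measurable_ofR (f : T -> R) :
  measurable_fun setT f -> cx_measurable (fun t => ofR (f t)).
Proof. by move=> mf; split => //; exact: measurable_cst. Qed.

Lemma cx_measurableD f g : cx_measurable f -> cx_measurable g ->
  cx_measurable (fun t => f t + g t).
Proof.
move=> [f1 f2] [g1 g2]; split.
- under eq_fun do rewrite (raddfD (@re R)); exact: measurable_funD.
- under eq_fun do rewrite (raddfD (@im R)); exact: measurable_funD.
Qed.

Lemma cx_measurableM f g : cx_measurable f -> cx_measurable g ->
  cx_measurable (fun t => f t * g t).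
Proof.
move=> [f1 f2] [g1 g2]; split.
- under eq_fun do rewrite reM; apply: measurable_funB; exact: measurable_funM.
- under eq_fun do rewrite imM; apply: measurable_funD; exact: measurable_funM.
Qed.

Lemma cx_measurable_conj f : cx_measurable f -> cx_measurable (fun t => (f t)^*).
Proof.
move=> [f1 f2]; split; first by under eq_fun do rewrite re_conj.
under eq_fun do rewrite im_conj; exact: measurable_funN.
Qed.

Lemma cx_measurable_sum I (r : seq I) (F : I -> T -> C) :
  (forall i, cx_measurable (F i)) -> cx_measurable (fun t => \sum_(i <- r) F i t).
Proof.
move=> mF; elim: r => [|i r IH].
  by under eq_fun do rewrite big_nil; exact: cx_measurable_cst.
by under eq_fun do rewrite big_cons; exact: cx_measurableD.
Qed.

Lemma mx_measurable_cst p q (A : 'M[C]_(p, q)) : mx_measurable (fun _ : T => A).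
Proof. by move=> i j; exact: cx_measurable_cst. Qed.

Lemma mx_measurableM p q s (Z : T -> 'M[C]_(p, q)) (W : T -> 'M[C]_(q, s)) :
  mx_measurable Z -> mx_measurable W -> mx_measurable (fun t => Z t *m W t).
Proof.
move=> mZ mW i j; under eq_fun do rewrite mxE.
by apply: cx_measurable_sum => k; exact: cx_measurableM.
Qed.

Lemma mx_measurable_adj p q (Z : T -> 'M[C]_(p, q)) :
  mx_measurable Z -> mx_measurable (fun t => (Z t)^t*).
Proof.
by move=> mZ i j; under eq_fun do rewrite adjE; exact: cx_measurable_conj.
Qed.

Lemma mx_measurableD p q (Z W : T -> 'M[C]_(p, q)) :
  mx_measurable Z -> mx_measurable W -> mx_measurable (fun t => Z t + W t).
Proof.
by move=> mZ mW i j; under eq_fun do rewrite mxE; exact: cx_measurableD.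
Qed.

Lemma mx_measurableZ p q f (Z : T -> 'M[C]_(p, q)) :
  cx_measurable f -> mx_measurable Z -> mx_measurable (fun t => f t *: Z t).
Proof.
by move=> mf mZ i j; under eq_fun do rewrite mxE; exact: cx_measurableM.
Qed.

Lemma mx_measurable_pow p (Z : T -> 'M[C]_p) k :
  mx_measurable Z -> mx_measurable (fun t => mxpow (Z t) k).
Proof.
move=> mZ; elim: k => [|k IH]; first exact: mx_measurable_cst.
exact: mx_measurableM.
Qed.

Lemma measurable_retr p (Z : T -> 'M[C]_p) :
  mx_measurable Z -> measurable_fun setT (fun t => re (\tr (Z t))).
Proof. by move=> mZ; apply: (cx_measurable_sum _ _).1. Qed.

Lemma mx_measurable_rdm m n (phi : T -> 'cV[C]_(m * n)) :
  mx_measurable phi -> mx_measurable (fun t => rdm (phi t)).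
Proof.
move=> mphi i j; under eq_fun do rewrite mxE.
apply: cx_measurable_sum => k; apply: mx_measurableM => //.
exact: mx_measurable_adj.
Qed.

Lemma measurable_eta_poly N p (a : T -> R) (A : T -> 'M[C]_p) :
  measurable_fun setT a -> mx_measurable A ->
  measurable_fun setT (fun t => eta_poly N (a t) (A t)).
Proof.
move=> ma mA; rewrite /eta_poly.
have mB k : measurable_fun setT
    (fun t => re (\tr (mxpow (1%:M - ofR (a t) *: A t) k))).
  apply: measurable_retr; apply: mx_measurable_pow.
  under eq_fun do rewrite -scaleNr -rmorphN.
  apply: mx_measurableD; first exact: mx_measurable_cst.
  by apply: mx_measurableZ => //; apply/cx_measurable_ofR/measurable_funN.
apply: measurable_funB => //; apply: measurable_sum => k.
by apply: measurable_funM => //; exact: measurable_cst.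
Qed.

Lemma measurable_entN N m n (phi : T -> 'cV[C]_(m * n)) :
  mx_measurable phi -> measurable_fun setT (fun t => entN N (phi t)).
Proof.
move=> mphi; under eq_fun do rewrite entN_poly.
by apply: measurable_eta_poly; [exact: measurable_cst|exact: mx_measurable_rdm].
Qed.

(** The entropy is a pointwise limit of the polynomial expressions of [ent_entropy_approx]. Vectors
    of any norm are allowed, since [U] ranges over all matrices and not only over unitary ones; the
    scale 1/t is written as [expR (- ln t)], a composition of measurable functions. *)
Lemma measurable_ent_entropy m n (phi : T -> 'cV[C]_(m * n)) :
  mx_measurable phi -> measurable_fun setT (fun t => ent_entropy (phi t)).
Proof.
move=> mphi; have ln2 : ln 2 != 0 :> R by rewrite gt_eqF// ln_gt0// ltr1n.
have -> : (fun t => ent_entropy (phi t)) =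
    (fun t => (ln 2)^-1 * (ln 2 * ent_entropy (phi t))).
  by apply/funext => t; rewrite mulrA mulVf// mul1r.
apply: measurable_funM; first exact: measurable_cst.
have mrho := mx_measurable_rdm mphi; have mt := measurable_retr mrho.
have mln := measurableT_comp (@measurable_ln R) mt.
pose h N t := - (re (\tr (rdm (phi t))) * ln (re (\tr (rdm (phi t)))))
  + re (\tr (rdm (phi t))) *
    eta_poly N (expR (- ln (re (\tr (rdm (phi t)))))) (rdm (phi t)).
apply: (@measurable_fun_cvg _ _ _ _ h) => [N|t _].
  apply: measurable_funD; first by apply/measurable_funN/measurable_funM.
  apply: measurable_funM => //; apply: measurable_eta_poly => //.
  apply: (measurableT_comp (@measurable_expR R)); exact: measurable_funN.
set l := ln 2 * _; pose b N := re (\tr (rdm (phi t))) * m%:R * harmonic N.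
have b0 : b @ \oo --> 0.
  rewrite -[0](mulr0 (re (\tr (rdm (phi t))) * m%:R)).
  by apply: cvgMr; exact: cvg_harmonic.
apply: (@squeeze_cvgr _ _ _ _ (fun N => l - b N) (fun N => l + b N)).
- near=> N; have : `|l - h N t| <= b N := ent_entropy_approx N (phi t).
  by rewrite ler_norml => /andP[h1 h2]; apply/andP; split; lra.
- by rewrite -[X in _ --> X]subr0; apply: cvgB => //; exact: cvg_cst.
- by rewrite -[X in _ --> X]addr0; apply: cvgD => //; exact: cvg_cst.
Unshelve. all: by end_near.
Qed.

End Calculus.

Lemma mx_measurable_id n : mx_measurable (fun U : borelM R n => (U : 'M[C]_n)).
Proof.
move=> i j.
suff cont (f : C -> R) : continuous f ->
    measurable_fun [set: borelM R n] (fun U : borelM R n => f ((U : 'M[C]_n) i j)).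
  split; apply: cont => z;
    apply/(@cvgrPdist_lt _ _ _ _ (nbhs_filter z)) => e e0.
    have := nbhsx_ballx z (ofR e); rewrite ofR_gt0 => /(_ e0).
    by apply: filterS => w /norm_re_im_lt[+ _]; rewrite (raddfB (@re R)).
  have := nbhsx_ballx z (ofR e); rewrite ofR_gt0 => /(_ e0).
  by apply: filterS => w /norm_re_im_lt[_ +]; rewrite (raddfB (@im R)).
move=> cf; apply: (measurability _ (RGenOpens.measurableE R)).
move=> _ [_ [a [b ->] <-]]; rewrite setTI; apply: sub_sigma_algebra.
have /continuousP cfij : continuous (fun U : 'M[C]_n => f (U i j)).
  by move=> U; apply: continuous_comp; [exact: coord_continuous|exact: cf].
by apply: cfij; exact: interval_open.
Qed.

End MeasurableMatrix.

(** The pushforward in [Ex_left] takes values in the matrix space with its Borel sigma-algebra, so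
    entrywise measurability is not enough there and continuity is used. *)
Lemma measurable_mulmxl (R : realType) n (V : 'M[Cx R]_n) :
  measurable_fun [set: borelM R n]
    ((fun U : 'M[Cx R]_n => V *m U) : borelM R n -> borelM R n).
Proof.
have cont i j : continuous (fun W : 'M[Cx R]_n => (V *m W) i j).
  rewrite (_ : (fun W => _) = fun W : 'M[Cx R]_n => \sum_k V i k * W k j); last first.
    by apply/funext => W; rewrite mxE.
  apply: (@continuous_big _ _ +%R 0 xpredT) => [|k _]; first exact: add_continuous.
  move=> U; apply: (@cvgM _ _ _ (nbhs_filter U)).
    exact: (@cvg_cst _ _ _ _ (nbhs_filter U)).
  exact: coord_continuous.
have /continuousP cV : continuous (fun U : 'M[Cx R]_n => V *m U).
  move=> U A [P VUP PA]; rewrite nbhs_simpl /=.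
  apply: (@filterS _ _ _ [set W : 'M[Cx R]_n | forall i j, P i j ((V *m W) i j)]).
    by move=> W; exact: PA.
  apply: (@filter_forall _ _ (fun i => [set W : 'M[Cx R]_n |
    forall j, P i j ((V *m W) i j)]) _ (nbhs_filter U)) => i.
  apply: (@filter_forall _ _ (fun j => [set W : 'M[Cx R]_n |
    P i j ((V *m W) i j)]) _ (nbhs_filter U)) => j.
  by apply: (cont i j U); exact: VUP.
apply: (@measurability _ _ (borelM R n) (borelM R n) setT (mulmx V)
  (@open 'M[Cx R]_n) erefl) => _ [B oB <-].
by rewrite setTI; apply: sub_sigma_algebra; exact: cV.
Qed.

(** * Expectations over the unitary group *)

Section Haar.
Variables (R : realType) (n : nat) (K : {vspace 'cV[Cx R]_n}).
Variables (mu : probability (borelM R n) R) (haar_mu : is_haar K mu).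
Local Notation C := (Cx R).
Local Notation G := (unitary_group K).
Implicit Types (g h : 'M[C]_n -> R).

Lemma measurable_mx_eq d (T : measurableType d) p q (Z : T -> 'M[C]_(p, q)) A :
  mx_measurable Z -> measurable [set t | Z t = A].
Proof.
move=> mZ; pose s t := \sum_i \sum_j nsq ((Z t - A) i j).
have ms : measurable_fun setT s.
  have mZA : mx_measurable (fun t => Z t - A).
    by apply: mx_measurableD => //; exact: mx_measurable_cst.
  apply: measurable_sum => i; apply: measurable_sum => j.
  have [m1 m2] := mZA i j.
  by apply: measurable_funD; exact: measurable_funX.
have -> : [set t | Z t = A] = setT `&` s @^-1` [set 0].
  rewrite setTI; apply/seteqP; split => t /=.
    move=> ZA; rewrite /s big1// => i _; rewrite big1// => j _.
    by rewrite ZA subrr mxE /nsq (raddf0 (@re R)) (raddf0 (@im R)) expr0n addr0.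
  move=> /eqP; rewrite psumr_eq0 => [/allP h|i _]; last first.
    by apply: sumr_ge0 => j _; exact: nsq_ge0.
  apply/eqP; rewrite -subr_eq0; apply/eqP/matrixP => i j; rewrite [RHS]mxE.
  have := h i (mem_index_enum i).
  rewrite psumr_eq0 => [/allP/(_ j (mem_index_enum j))/eqP/nsq_eq0//|k _].
  exact: nsq_ge0.
by apply: ms => //; exact: measurable_set1.
Qed.

Lemma measurable_unitary_group : measurable (G : set (borelM R n)).
Proof.
have -> : (G : set (borelM R n)) =
    [set U : borelM R n | (U : 'M[C]_n) *m (U : 'M[C]_n)^t* = 1%:M] `&`
    [set U : borelM R n | (U : 'M[C]_n) *m (1%:M - orthoproj K) = 1%:M - orthoproj K].
  by apply/seteqP; split => U /unitary_groupP.
have mid := @mx_measurable_id R n.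
apply: measurableI; apply: measurable_mx_eq; apply: mx_measurableM => //.
exact: mx_measurable_adj.
Qed.

Definition retract (U : borelM R n) : 'M[C]_n := if `[< G U >] then U else 1%:M.

Lemma retractP U : G (retract U).
Proof. by rewrite /retract; case: asboolP => // _; exact: unitary_group1. Qed.

Lemma retract_id U : G U -> retract U = U.
Proof. by rewrite /retract; case: asboolP. Qed.

Lemma mx_measurable_retract : mx_measurable retract.
Proof.
have mG : measurable_fun [set: borelM R n] (fun U : borelM R n => `[< G U >]).
  apply: (measurable_fun_bool true); rewrite setTI.
  rewrite (_ : _ @^-1` _ = (G : set (borelM R n))); first exact: measurable_unitary_group.
  by apply/seteqP; split => U /=; [move/asboolP|move=> ?; apply/asboolP].
move=> i j; have [m1 m2] := @mx_measurable_id R n i j.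
split.
- rewrite (_ : (fun _ => _) = fun U : borelM R n =>
    if `[< G U >] then re ((U : 'M[C]_n) i j) else re ((1%:M : 'M[C]_n) i j)).
    by apply: measurable_fun_ifT => //; exact: measurable_cst.
  by apply/funext => U; rewrite /retract; case: ifP.
- rewrite (_ : (fun _ => _) = fun U : borelM R n =>
    if `[< G U >] then im ((U : 'M[C]_n) i j) else im ((1%:M : 'M[C]_n) i j)).
    by apply: measurable_fun_ifT => //; exact: measurable_cst.
  by apply/funext => U; rewrite /retract; case: ifP.
Qed.

(** Quantifying over all measurable maps into matrices makes this class stable under composition
    with products and adjoints, and covers functions of two independent variables. *)
Definition mx_mfun g : Prop := forall d (T : measurableType d) (Z : T -> 'M[C]_n),
  mx_measurable Z -> measurable_fun setT (fun t => g (Z t)).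

Definition mx_mfun2 (h : 'M[C]_n -> 'M[C]_n -> R) : Prop :=
  forall d (T : measurableType d) (Z W : T -> 'M[C]_n),
  mx_measurable Z -> mx_measurable W -> measurable_fun setT (fun t => h (Z t) (W t)).

Definition Gbounded g : Prop := exists M, forall U, G U -> `|g U| <= M.

Definition admissible g := mx_mfun g /\ Gbounded g.

(* Composing with [retract] makes functions that are bounded on [G] bounded. *)
Definition Ex g : R := (\int[mu]_U g (retract U))%R.

Lemma admissible_integrable g : admissible g ->
  mu.-integrable setT (EFin \o (fun U => g (retract U))).
Proof.
move=> [mg [M gM]]; apply: measurable_bounded_integrable => //.
- by rewrite (le_lt_trans (probability_le1 _ _))// ltry.
- exact: mg mx_measurable_retract.
- exists M; split; first exact: num_real.
  by move=> x Mx U _; apply: le_trans (ltW Mx); apply: gM; exact: retractP.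
Qed.

Lemma Ex_ext g h : (forall U, G U -> g U = h U) -> Ex g = Ex h.
Proof. by move=> gh; congr fine; apply: eq_integral => U _; rewrite gh//; exact: retractP. Qed.

Lemma Ex_cst (a : R) : Ex (fun=> a) = a.
Proof. rewrite /Ex Rintegral_cst; last exact: measurableT.
by rewrite -[RHS]mulr1; congr (_ * _); exact: (congr1 fine (probability_setT mu)). Qed.

Lemma Ex_le g h : admissible g -> admissible h ->
  (forall U, G U -> g U <= h U) -> Ex g <= Ex h.
Proof.
move=> ag ah gh; apply: le_Rintegral => //; try exact: admissible_integrable.
by move=> U _; apply: gh; exact: retractP.
Qed.

Lemma ExD g h : admissible g -> admissible h ->
  Ex (fun U => g U + h U) = Ex g + Ex h.
Proof. by move=> ag ah; apply: RintegralD => //; exact: admissible_integrable. Qed.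

Lemma ExZ a g : admissible g -> Ex (fun U => a * g U) = a * Ex g.
Proof. by move=> ag; apply: RintegralZl => //; exact: admissible_integrable. Qed.

Lemma admissible_cst a : admissible (fun=> a).
Proof.
split; first by move=> *; exact: measurable_cst.
by exists `|a|.
Qed.

Lemma admissibleD g h : admissible g -> admissible h -> admissible (fun U => g U + h U).
Proof.
move=> [mg [M gM]] [mh [N hN]]; split.
  by move=> d T Z mZ; apply: measurable_funD; [exact: mg|exact: mh].
by exists (M + N) => U GU; rewrite (le_trans (ler_normD _ _))// lerD ?gM ?hN.
Qed.

Lemma admissibleM g h : admissible g -> admissible h -> admissible (fun U => g U * h U).
Proof.
move=> [mg [M gM]] [mh [N hN]]; split.
  by move=> d T Z mZ; apply: measurable_funM; [exact: mg|exact: mh].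
by exists (M * N) => U GU; rewrite normrM ler_pM ?gM ?hN.
Qed.

Lemma admissible_exp g : admissible g -> admissible (fun U => expR (g U)).
Proof.
move=> [mg [M gM]]; split.
  by move=> d T Z mZ; apply: (measurableT_comp (@measurable_expR R)); exact: mg.
exists (expR M) => U GU; rewrite ger0_norm ?expR_ge0// ler_expR.
by rewrite (le_trans (ler_norm _))// gM.
Qed.

Lemma admissible_sum I (s : seq I) (g : I -> 'M[C]_n -> R) :
  (forall i, admissible (g i)) -> admissible (fun U => \sum_(i <- s) g i U).
Proof.
move=> ag; elim: s => [|i s IH].
  rewrite (_ : (fun _ => _) = fun=> 0); first exact: admissible_cst.
  by apply/funext => U; rewrite big_nil.
rewrite (_ : (fun _ => _) = fun U => g i U + \sum_(j <- s) g j U).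
  exact: admissibleD.
by apply/funext => U; rewrite big_cons.
Qed.

Lemma Ex_sum I (s : seq I) (g : I -> 'M[C]_n -> R) :
  (forall i, admissible (g i)) ->
  Ex (fun U => \sum_(i <- s) g i U) = \sum_(i <- s) Ex (g i).
Proof.
move=> ag; elim: s => [|i s IH].
  by rewrite big_nil -[RHS]Ex_cst; apply: Ex_ext => U _; rewrite big_nil.
rewrite big_cons -IH -ExD//; last exact: admissible_sum.
by apply: Ex_ext => U _; rewrite big_cons.
Qed.

Lemma eq_integral_unitary_group (f1 f2 : borelM R n -> R) :
  measurable_fun setT f1 -> measurable_fun setT f2 ->
  (forall U, G U -> f1 U = f2 U) ->
  (\int[mu]_U (f1 U)%:E = \int[mu]_U (f2 U)%:E)%E.
Proof.
move=> m1 m2 f12; have mG := measurable_unitary_group.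
apply: ae_eq_integral => //.
- exact/measurable_EFinP.
- exact/measurable_EFinP.
exists (~` (G : set (borelM R n))); split; first exact: measurableC.
  by apply: (etrans (probability_setC mu mG)); rewrite haar_mu.1 subee.
by move=> U /= h GU; apply: h => _; rewrite f12.
Qed.

Lemma admissible_left g V : admissible g -> G V -> admissible (fun U => g (V *m U)).
Proof.
move=> [mg [M gM]] GV; split.
  move=> d T Z mZ; apply: mg; apply: mx_measurableM => //; exact: mx_measurable_cst.
by exists M => U GU; apply: gM; exact: unitary_groupM.
Qed.

(** [retract] commutes with multiplication by [V] only on [G], which has full measure. Once the
    integrand is exchanged there, the change of variables is exactly the invariance of [mu]. *)
Lemma Ex_left g V : admissible g -> G V -> Ex (fun U => g (V *m U)) = Ex g.
Proof.
move=> ag GV; have ag' := admissible_left ag GV.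
pose phi (U : borelM R n) : borelM R n := V *m (U : 'M[C]_n).
have mphi : measurable_fun setT phi := measurable_mulmxl V.
pose g' (U : borelM R n) : R := g (retract U).
have mg' : measurable_fun setT g' := ag.1 _ _ _ mx_measurable_retract.
rewrite /Ex /Rintegral; congr fine.
transitivity (\int[mu]_U (g' (phi U))%:E)%E.
  apply: eq_integral_unitary_group => [||U GU].
  - exact: ag'.1 _ _ _ mx_measurable_retract.
  - exact: measurableT_comp.
  - by rewrite /g' /phi !retract_id//; exact: unitary_groupM.
transitivity (\int[pushforward mu phi]_U (g' U)%:E)%E.
  rewrite integral_pushforward//; first exact/measurable_EFinP.
  rewrite preimage_setT; apply: measurable_bounded_integrable => //.
  - by rewrite (le_lt_trans (probability_le1 _ _))// ltry.
  - exact: measurableT_comp.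
  - have [M gM] := ag.2; exists M; split; first exact: num_real.
    by move=> x Mx U _; apply: le_trans (ltW Mx); apply: gM; exact: retractP.
apply: eq_measure_integral => X mX _.
exact: haar_mu.2.
Qed.

Section TwoVariables.
Variables (h : 'M[C]_n -> 'M[C]_n -> R) (M : R).
Hypothesis mh : mx_mfun2 h.
Hypothesis hM : forall U V, G U -> G V -> `|h U V| <= M.

Let f (z : borelM R n * borelM R n) : \bar R := (h (retract z.1) (retract z.2))%:E.

Let mf : measurable_fun setT f.
Proof.
apply/measurable_EFinP; apply: mh => i j; have [m1 m2] := mx_measurable_retract i j.
  by split; [exact: (measurableT_comp m1 measurable_fst)
    |exact: (measurableT_comp m2 measurable_fst)].
by split; [exact: (measurableT_comp m1 measurable_snd)
  |exact: (measurableT_comp m2 measurable_snd)].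
Qed.

Let integrable_f : (mu \x mu)%E.-integrable setT f.
Proof.
have intM : (\int[mu]_U M%:E = M%:E)%E.
  rewrite integral_cst; last exact: measurableT.
  by apply: (etrans (congr1 (mule _) (probability_setT mu))); rewrite mule1.
have M0 : 0 <= M :=
  le_trans (normr_ge0 _) (hM (unitary_group1 K) (unitary_group1 K)).
apply/integrable12ltyP => //; apply: (@le_lt_trans _ _ (\int[mu]_U M%:E)%E).
  apply: ge0_le_integral => //.
  - by move=> U _; apply: integral_ge0.
  - apply: (measurable_fun_fubini_tonelli_F (fun z => `|f z|%E)) => //.
    exact: measurableT_comp.
  - move=> U _; apply: (@le_trans _ _ (\int[mu]_V M%:E)%E).
      apply: ge0_le_integral => //.
      + apply: measurableT_comp => //; exact: (measurable_fun_pair2 _ mf).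
      + by move=> V _; rewrite lee_fin hM//; exact: retractP.
    by rewrite intM.
by rewrite intM ltry.
Qed.

Lemma admissible_section1 U : G U -> admissible (h U).
Proof.
move=> GU; split; last by exists M => V; exact: hM.
by move=> d T Z mZ; apply: mh => //; exact: mx_measurable_cst.
Qed.

Lemma admissible_section2 V : G V -> admissible (h^~ V).
Proof.
move=> GV; split; last by exists M => U GU; exact: hM.
by move=> d T Z mZ; apply: mh => //; exact: mx_measurable_cst.
Qed.

Lemma integral_Ex k : admissible k -> (\int[mu]_V (k (retract V))%:E = (Ex k)%:E)%E.
Proof.
by move=> ak; rewrite fineK//; apply: integrable_fin_num => //; exact: admissible_integrable.
Qed.

Lemma Ex_swap : Ex (fun U => Ex (h U)) = Ex (fun V => Ex (h^~ V)).
Proof.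
have := Fubini integrable_f; rewrite /f /=.
under eq_integral => U _.
  rewrite (integral_Ex (admissible_section1 (retractP U))); over.
under [X in _ = X -> _]eq_integral => V _.
  rewrite (integral_Ex (admissible_section2 (retractP V))); over.
by move=> /(congr1 fine).
Qed.

Lemma integrable_Ex1 : mu.-integrable setT (EFin \o (fun U => Ex (h (retract U)))).
Proof.
have := integrable_fubini_F integrable_f; apply: eq_integrable => // U _.
by rewrite /fubini_F /f /= (integral_Ex (admissible_section1 (retractP U))).
Qed.

(** The inner expectation is known to be integrable but not to be [admissible], so [Ex_le] does not
    apply to it. *)
Lemma Ex_Ex_ge g : admissible g -> (forall U, G U -> g U <= Ex (h U)) ->
  Ex g <= Ex (fun U => Ex (h U)).
Proof.
move=> ag gh; apply: le_Rintegral => //; first exact: admissible_integrable.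
  exact: integrable_Ex1.
by move=> U _; apply: gh; exact: retractP.
Qed.

Lemma Ex_Ex_le g : admissible g -> (forall U, G U -> Ex (h U) <= g U) ->
  Ex (fun U => Ex (h U)) <= Ex g.
Proof.
move=> ag gh; apply: le_Rintegral => //; last first.
- by move=> U _; apply: gh; exact: retractP.
- exact: admissible_integrable.
- exact: integrable_Ex1.
Qed.

End TwoVariables.

(** Integrate g at the product of the adjoint of V with U in both orders. Over U, left invariance
    gives the mean of g; over V, the product is the adjoint of a left translate of V, which gives
    the mean of g after inversion. *)
Lemma Ex_inv g : admissible g -> Ex (fun U => g (U^t*)) = Ex g.
Proof.
move=> [mg [M gM]]; pose h (V U : 'M[C]_n) := g (V^t* *m U).
have mh : mx_mfun2 h.
  move=> d T Z W mZ mW; apply: mg; apply: mx_measurableM => //.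
  exact: mx_measurable_adj.
have hM U V : G U -> G V -> `|h U V| <= M.
  by move=> GU GV; apply: gM; apply: unitary_groupM => //; exact: unitary_groupV.
have ag : admissible g by split=> //; exists M.
have ag' : admissible (fun U => g (U^t*)).
  split; first by move=> d T Z mZ; apply: mg; exact: mx_measurable_adj.
  by exists M => U GU; apply: gM; exact: unitary_groupV.
have hl : Ex (fun V => Ex (h V)) = Ex g.
  rewrite -[RHS]Ex_cst; apply: Ex_ext => V GV.
  by apply: Ex_left => //; exact: unitary_groupV.
have hr : Ex (fun U => Ex (h^~ U)) = Ex (fun U => g (U^t*)).
  rewrite -[RHS]Ex_cst; apply: Ex_ext => U GU.
  rewrite -(Ex_left ag' (unitary_groupV GU)); apply: Ex_ext => V GV.
  by rewrite /h adjM trmxCK.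
by rewrite -hr -hl (Ex_swap mh hM).
Qed.

(** Inversion turns right multiplication into left multiplication by the adjoint. *)
Lemma Ex_right g W : admissible g -> G W -> Ex (fun U => g (U *m W)) = Ex g.
Proof.
move=> ag GW; have [mg [M gM]] := ag.
have ag' : admissible (fun U => g (U^t*)).
  split; first by move=> d T Z mZ; apply: mg; exact: mx_measurable_adj.
  by exists M => U GU; apply: gM; exact: unitary_groupV.
have ag'' : admissible (fun U => g (U *m W)).
  split; last by exists M => U GU; apply: gM; exact: unitary_groupM.
  move=> d T Z mZ; apply: mg; apply: mx_measurableM => //; exact: mx_measurable_cst.
rewrite -(Ex_inv ag'') -[RHS](Ex_inv ag) -[RHS](Ex_left ag' (unitary_groupV GW)).
by apply: Ex_ext => U _; rewrite adjM trmxCK.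
Qed.

Lemma markov_Ex g (A : set (borelM R n)) : measurable A -> admissible g ->
  (forall U, G U -> 0 <= g U) -> (forall U, A U -> G U -> 1 <= g U) ->
  (mu A <= (Ex g)%:E)%E.
Proof.
move=> mA ag g0 g1.
have <- : (\int[mu]_U (\1_A U)%:E = mu A)%E by rewrite integral_indic// setIT.
rewrite -(integral_Ex ag).
(* Off [G] the indicator need not be below [g]. The maximum dominates it everywhere and differs from
   [g] only on a null set. *)
pose k U : R := Num.max (\1_A U) (g (retract U)).
have mg : measurable_fun setT (fun U => g (retract U)) := ag.1 _ _ _ mx_measurable_retract.
have mk : measurable_fun setT k by apply: measurable_maxr => //; exact: measurable_indic.
have -> : (\int[mu]_U (g (retract U))%:E = \int[mu]_U (k U)%:E)%E.
  apply: eq_integral_unitary_group => // U GU.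
  rewrite /k indicE; apply/esym/max_idPr; case: (boolP (U \in A)) => [|_] /=.
    by rewrite inE => AU; rewrite retract_id// g1.
  by rewrite g0//; exact: retractP.
apply: ge0_le_integral => //.
- by apply/measurable_EFinP; exact: measurable_indic.
- exact/measurable_EFinP.
- by move=> U _; rewrite lee_fin le_max lexx.
Qed.

End Haar.

(** * Mean purity *)

Section PurityPolar.
Variable C : numClosedFieldType.

Definition gram2 m n (A : 'M[C]_(m, n)) : C := \tr (A *m A^t* *m (A *m A^t*)).

Lemma gram2_adj m n (A : 'M[C]_(m, n)) :
  gram2 A = \tr (A^t* *m A *m (A^t* *m A)).
Proof. by rewrite /gram2 -mulmxA mxtrace_mulC -!mulmxA. Qed.

(* Averaging over the fourth roots of unity kills all terms that are not
   invariant under [B |-> w B]. *)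
Lemma gram2_polar m n (A B : 'M[C]_(m, n)) (s : C) : s^* = s -> s ^+ 2 = 2^-1 ->
  \sum_(w <- [:: 1; -1; 'i; - 'i]) gram2 (s *: (A + w *: B)) =
  gram2 A + gram2 B +
  2 * (\tr (A *m A^t* *m (B *m B^t*)) + \tr (A^t* *m A *m (B^t* *m B))).
Proof.
move=> hs s2.
have -> : \tr (A^t* *m A *m (B^t* *m B)) = \tr (B *m A^t* *m (A *m B^t*)).
  by rewrite mulmxA mxtrace_mulC !mulmxA.
set X := B *m A^t*; set Y := A *m B^t*; set S := A *m A^t*; set T := B *m B^t*.
have exp w : w * w^* = 1 -> gram2 (s *: (A + w *: B)) =
    4^-1 * (\tr (S *m S) + \tr (T *m T) + 2 * \tr (S *m T) + 2 * \tr (X *m Y)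
      + w ^+ 2 * \tr (X *m X) + w^* ^+ 2 * \tr (Y *m Y)
      + 2 * w * (\tr (S *m X) + \tr (T *m X))
      + 2 * w^* * (\tr (S *m Y) + \tr (T *m Y))).
  move=> ww; rewrite /gram2.
  have -> : s *: (A + w *: B) *m (s *: (A + w *: B))^t* =
      2^-1 *: (S + T + w *: X + w^* *: Y).
    rewrite adjZ hs adjD adjZ -scalemxAl -scalemxAr scalerA -expr2 s2.
    congr (_ *: _); rewrite mulmxDl !mulmxDr -!scalemxAl -!scalemxAr scalerA ww scale1r.
    rewrite -/S -/T -/X -/Y; apply/matrixP => i j; rewrite !mxE; ring.
  rewrite -scalemxAl -scalemxAr scalerA mxtraceZ.
  rewrite !mulmxDl !mulmxDr -!scalemxAl -!scalemxAr !mxtraceD !mxtraceZ.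
  rewrite (mxtrace_mulC T S) (mxtrace_mulC X S) (mxtrace_mulC Y S).
  rewrite (mxtrace_mulC X T) (mxtrace_mulC Y T) (mxtrace_mulC Y X).
  have w0 : w != 0.
    by apply: contra_eq_neq ww => ->; rewrite mul0r eq_sym oner_neq0.
  have -> : w^* = w^-1 by rewrite -[LHS](mulKf w0) ww mulr1.
  by field.
have i2 : 'i * 'i = -1 :> C by rewrite -expr2 sqrCi.
rewrite !big_cons big_nil addr0 !exp.
- by rewrite !rmorphN /= !(conjC1, conjCi, opprK, sqrrN, sqrCi) /gram2 -/S -/T; field.
- by rewrite rmorphN /= conjCi opprK mulNr i2 opprK.
- by rewrite conjCi mulrN i2 opprK.
- by rewrite rmorphN /= conjC1 mulrNN mulr1.
- by rewrite conjC1 mulr1.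
Qed.

Lemma gram2_pairs m n I (r : seq I) (A : I -> 'M[C]_(m, n)) :
  \sum_(i <- r) \sum_(k <- r) (\tr (A i *m (A i)^t* *m (A k *m (A k)^t*)) +
    \tr ((A i)^t* *m A i *m ((A k)^t* *m A k))) =
  \tr ((\sum_(i <- r) A i *m (A i)^t*) *m (\sum_(i <- r) A i *m (A i)^t*)) +
  \tr ((\sum_(i <- r) (A i)^t* *m A i) *m (\sum_(i <- r) (A i)^t* *m A i)).
Proof.
rewrite !mulmx_suml !raddf_sum -big_split /=; apply: eq_bigr => i _.
by rewrite !mulmx_sumr !raddf_sum -big_split.
Qed.

Lemma tensor_mxZ m n (u : 'cV[C]_(m * n)) a :
  tensor_mx (a *: u) = a *: tensor_mx u.
Proof. by apply/matrixP => i j; rewrite !mxE. Qed.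

End PurityPolar.

Section PurityMean.
Variables (R : realType) (m n : nat) (K : {vspace 'cV[Cx R]_(m * n)}).
Variables (mu : probability (borelM R (m * n)) R) (haar_mu : is_haar K mu).
Local Notation C := (Cx R).
Local Notation G := (unitary_group K).
Local Notation D := (\dim K).

Lemma ptrace2_sum I (r : seq I) (F : I -> 'M[C]_(m * n)) :
  ptrace2 (\sum_(i <- r) F i) = \sum_(i <- r) ptrace2 (F i).
Proof.
apply/matrixP => i j; rewrite summxE mxE.
under eq_bigr do rewrite summxE.
by rewrite exchange_big; apply: eq_bigr => k _; rewrite mxE.
Qed.

Lemma ptrace1_sum I (r : seq I) (F : I -> 'M[C]_(m * n)) :
  ptrace1 (\sum_(i <- r) F i) = \sum_(i <- r) ptrace1 (F i).
Proof.
apply/matrixP => i j; rewrite summxE mxE.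
under eq_bigr do rewrite summxE.
by rewrite exchange_big; apply: eq_bigr => k _; rewrite mxE.
Qed.

Lemma ptrace2Z a (M : 'M[C]_(m * n)) : ptrace2 (a *: M) = a *: ptrace2 M.
Proof.
by apply/matrixP => i j; rewrite !mxE mulr_sumr; apply: eq_bigr => k _; rewrite mxE.
Qed.

Lemma ptrace1Z a (M : 'M[C]_(m * n)) : ptrace1 (a *: M) = a *: ptrace1 M.
Proof.
by apply/matrixP => i j; rewrite !mxE mulr_sumr; apply: eq_bigr => k _; rewrite mxE.
Qed.

Lemma ptrace1_ketbra (phi : 'cV[C]_(m * n)) :
  ptrace1 (ketbra phi) = ((tensor_mx phi)^t* *m tensor_mx phi)^T.
Proof.
apply/matrixP => j k; rewrite !mxE; apply: eq_bigr => i _.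
by rewrite adjE !mxE big_ord1 adjE mulrC.
Qed.

Lemma purity_rdm (phi : 'cV[C]_(m * n)) : purity (rdm phi) = re (gram2 (tensor_mx phi)).
Proof. by rewrite /purity rdmE. Qed.

Lemma purityZ p (A : 'M[C]_p) (a : R) :
  purity (ofR a *: A) = a ^+ 2 * purity A.
Proof.
rewrite /purity -scalemxAl -scalemxAr scalerA mxtraceZ -rmorphM re_ofRM.
by rewrite -expr2.
Qed.

Lemma purity_trmx p (A : 'M[C]_p) : purity A^T = purity A.
Proof. by rewrite /purity -trmx_mul mxtrace_tr. Qed.

(* For an orthonormal basis [e] of [K], the sum over all pairs of [e] only
   depends on the projection onto [K], hence not on [U]. *)
Lemma sum_pairs_const (e : 'I_D -> 'cV[C]_(m * n)) U : G U ->
  \sum_i e i *m (e i)^t* = orthoproj K ->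
  let A i := tensor_mx (U *m e i) in
  \sum_i \sum_k (re (\tr (A i *m (A i)^t* *m (A k *m (A k)^t*))) +
    re (\tr ((A i)^t* *m A i *m ((A k)^t* *m A k)))) =
  purity (ptrace2 (orthoproj K)) + purity (ptrace1 (orthoproj K)).
Proof.
move=> GU eP A.
have PiE : orthoproj K = \sum_i ketbra (U *m e i).
  rewrite -(unitary_group_conj GU) -eP mulmx_sumr mulmx_suml.
  by apply: eq_bigr => i _; rewrite /ketbra adjM !mulmxA.
have -> : ptrace2 (orthoproj K) = \sum_i A i *m (A i)^t*.
  by rewrite PiE ptrace2_sum; apply: eq_bigr => i _; exact: rdmE.
have -> : purity (ptrace1 (orthoproj K)) = purity (\sum_i (A i)^t* *m A i).
  rewrite -[RHS]purity_trmx linear_sum PiE ptrace1_sum; congr purity.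
  by apply: eq_bigr => i _; exact: ptrace1_ketbra.
rewrite /purity -raddfD /= -gram2_pairs raddf_sum; apply: eq_bigr => i _.
by rewrite /= raddf_sum; apply: eq_bigr => k _; rewrite /= raddfD.
Qed.

Definition vec_mfun p (f : 'cV[C]_p -> R) : Prop :=
  forall d (T : measurableType d) (Z : T -> 'cV[C]_p),
  mx_measurable Z -> measurable_fun setT (fun t => f (Z t)).

Lemma mx_measurable_mulmx d (T : measurableType d) p (Z : T -> 'M[C]_p) (x : 'cV[C]_p) :
  mx_measurable Z -> mx_measurable (fun t => Z t *m x).
Proof. by move=> mZ; apply: mx_measurableM => //; exact: mx_measurable_cst. Qed.

Lemma admissible_vec f M x : vec_mfun f ->
  (forall phi : 'cV[C]_(m * n), unit_vector phi -> `|f phi| <= M) ->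
  dot x x = 1 -> admissible K (fun U => f (U *m x)).
Proof.
move=> mf fM x1; split.
  by move=> d T Z mZ; apply: mf; exact: mx_measurable_mulmx.
by exists M => U GU; apply/fM/unit_dot; rewrite (unitary_group_dot _ _ GU).
Qed.

Lemma Ex_vec f M x y : vec_mfun f ->
  (forall phi : 'cV[C]_(m * n), unit_vector phi -> `|f phi| <= M) ->
  x \in K -> y \in K -> dot x x = 1 -> dot y y = 1 ->
  Ex K mu (fun U => f (U *m x)) = Ex K mu (fun U => f (U *m y)).
Proof.
move=> mf fM xK yK x1 y1.
have [W [GW <- _]] := unitary_group_trans xK yK x1 y1.
rewrite -(Ex_right haar_mu (admissible_vec mf fM x1) GW).
by apply: Ex_ext => U _; rewrite mulmxA.
Qed.

(** All unit vectors of [K] give the same mean, so only the sum of the coefficients matters. Lists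
    accommodate the mixture of basis vectors and superpositions that polarization produces. *)
Lemma Ex_vec_lin f M x (l : seq (R * 'cV[C]_(m * n))) : vec_mfun f ->
  (forall phi : 'cV[C]_(m * n), unit_vector phi -> `|f phi| <= M) ->
  x \in K -> dot x x = 1 ->
  (forall q, q \in l -> q.2 \in K /\ dot q.2 q.2 = 1) ->
  admissible K (fun U => \sum_(q <- l) q.1 * f (U *m q.2)) /\
  Ex K mu (fun U => \sum_(q <- l) q.1 * f (U *m q.2)) =
  (\sum_(q <- l) q.1) * Ex K mu (fun U => f (U *m x)).
Proof.
move=> mf fM xK x1; elim: l => [_|q l IH hl].
  rewrite !big_nil mul0r; split.
    rewrite (_ : (fun _ => _) = fun=> 0); first exact: admissible_cst.
    by apply/funext => U; rewrite big_nil.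
  by rewrite -[RHS](Ex_cst K mu); apply: Ex_ext => U _; rewrite big_nil.
have [qK q1] := hl q (mem_head _ _).
have [al El] := IH (fun q' h => hl q' (@mem_behead _ (q :: l) q' h)).
have aq : admissible K (fun U => f (U *m q.2)) := admissible_vec mf fM q1.
have aq' : admissible K (fun U => q.1 * f (U *m q.2)).
  by apply: admissibleM => //; exact: admissible_cst.
have -> : (fun U => \sum_(q <- q :: l) q.1 * f (U *m q.2)) =
    (fun U => q.1 * f (U *m q.2) + \sum_(q <- l) q.1 * f (U *m q.2)).
  by apply/funext => U; rewrite big_cons.
split; first exact: admissibleD.
have Eq : Ex K mu (fun U => f (U *m q.2)) = Ex K mu (fun U => f (U *m x)).
  exact: Ex_vec mf fM _ _ _ _.
by rewrite (ExD mu aq' al) El (ExZ mu _ aq) Eq big_cons mulrDl.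
Qed.

Lemma vec_mfun_purity : vec_mfun (fun phi : 'cV[C]_(m * n) => purity (rdm phi)).
Proof.
move=> d T Z mZ; apply: measurable_retr.
by apply: mx_measurableM; exact: mx_measurable_rdm.
Qed.

Lemma purity_rdm_bound (phi : 'cV[C]_(m * n)) : unit_vector phi ->
  `|purity (rdm phi)| <= 1.
Proof.
move=> u; rewrite purityE ?adj_rdm// ger0_norm.
  rewrite -[leRHS](sum_eig_rdm u); apply: ler_sum => i _.
  by rewrite expr2 ler_piMl ?eig_rdm_ge0 ?eig_rdm_le1.
by apply: sumr_ge0 => i _; exact: sqr_ge0.
Qed.

Lemma pair_polar (a b : 'cV[C]_(m * n)) (A := tensor_mx a) (B := tensor_mx b)
    (s := ofR (Num.sqrt 2)^-1) :
  re (\tr (A *m A^t* *m (B *m B^t*))) + re (\tr (A^t* *m A *m (B^t* *m B))) =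
  2^-1 * (\sum_(w <- [:: 1; -1; 'i; - 'i]) purity (rdm (s *: (a + w *: b)))
    - purity (rdm a) - purity (rdm b)).
Proof.
have s2 : s ^+ 2 = 2^-1.
  by rewrite /s -rmorphXn exprVn sqr_sqrtr// fmorphV rmorph_nat.
have := gram2_polar A B (conj_ofR _) s2 => /(congr1 (@re R)).
rewrite raddf_sum /= => h.
have -> : \sum_(w <- [:: 1; -1; 'i; - 'i]) purity (rdm (s *: (a + w *: b))) =
    \sum_(w <- [:: 1; -1; 'i; - 'i]) re (gram2 (s *: (A + w *: B))).
  apply: eq_bigr => w _; rewrite purity_rdm tensor_mxZ.
  by rewrite -[a]scale1r tensor_mxD scale1r.
rewrite h !purity_rdm -/A -/B.
have E2 (z : C) : 2 * z = z + z by rewrite mulr_natl mulr2n.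
move: (gram2 A) (gram2 B) (\tr (A *m A^t* *m _)) (\tr (A^t* *m A *m _)) => p q u v.
rewrite E2 !(raddfD (@re R)) /=.
by move: (re p) (re q) (re u) (re v) => p' q' u' v'; field.
Qed.

(** By polarization an off-diagonal pair has total coefficient 4/2 - 1/2 - 1/2 = 1 and a diagonal
    pair has 2, so the sum over all pairs has mean D (D + 1) times the mean purity. By
    [sum_pairs_const] that sum is also the constant D^2 times the two purities of [Omega K]. *)
Lemma Ex_purity x : x \in K -> dot x x = 1 ->
  Ex K mu (fun U => purity (rdm (U *m x))) = D%:R / (D%:R + 1) *
    (purity (ptrace2 (Omega K)) + purity (ptrace1 (Omega K))).
Proof.
move=> xK x1; have D0 := dim_gt0 xK x1.
have [e [eK ee eP]] := orthonormal_basis K.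
have e1 i : dot (e i) (e i) = 1 by rewrite ee eqxx.
pose s : C := ofR (Num.sqrt 2)^-1.
have ws (w : C) : w \in [:: 1; -1; 'i; - 'i] -> w^* * w = 1.
  have i2 : 'i * 'i = -1 :> C by rewrite -expr2 sqrCi.
  rewrite !inE => /or4P[]/eqP->.
  - by rewrite conjC1 mulr1.
  - by rewrite rmorphN /= conjC1 mulrNN mulr1.
  - by rewrite conjCi mulNr i2 opprK.
  - by rewrite rmorphN /= conjCi opprK mulrN i2 opprK.
pose y i k (w : C) := s *: (e i + w *: e k).
have yK i k w : y i k w \in K by rewrite memvZ// memvD// memvZ.
have y1 i k w : i != k -> w^* * w = 1 -> dot (y i k w) (y i k w) = 1.
  move=> ik ww; rewrite /y dotZl dotZr dotDl !dotDr !dotZl !dotZr !ee !eqxx.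
  rewrite [k == i]eq_sym (negPf ik) !mulr0 addr0 add0r mulr1 ww.
  rewrite conj_ofR mulrA -rmorphM -expr2 exprVn sqr_sqrtr// fmorphV rmorph_nat.
  by rewrite mulVf// pnatr_eq0.
set E := Ex K mu _.
pose F i k (U : 'M[C]_(m * n)) := re (\tr (tensor_mx (U *m e i) *m (tensor_mx (U *m e i))^t* *m
    (tensor_mx (U *m e k) *m (tensor_mx (U *m e k))^t*))) +
  re (\tr ((tensor_mx (U *m e i))^t* *m tensor_mx (U *m e i) *m
    ((tensor_mx (U *m e k))^t* *m tensor_mx (U *m e k)))).
pose l i k : seq (R * 'cV[C]_(m * n)) := if i == k then [:: (2, e i)] else
  [:: (- 2^-1, e i), (- 2^-1, e k) &
    [seq (2^-1, y i k w) | w <- [:: 1; -1; 'i; - 'i]]].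
have arith (p q r : R) : 2^-1 * (p - q - r) = - 2^-1 * q + (- 2^-1 * r + 2^-1 * p).
  by ring.
have FE i k U : F i k U = \sum_(q <- l i k) q.1 * purity (rdm (U *m q.2)).
  rewrite /F /l; have [<-|ik] := eqVneq i k.
    rewrite big_seq1 /= -[X in re X]/(gram2 _) -gram2_adj purity_rdm.
    by rewrite mulr_natl mulr2n.
  rewrite pair_polar [RHS]big_cons [X in _ = _ + X]big_cons.
  rewrite [X in _ = _ + (_ + X)]big_map /= -mulr_sumr -/s.
  have sumE : \sum_(w <- [:: 1; -1; 'i; - 'i])
        purity (rdm (s *: (U *m e i + w *: (U *m e k)))) =
      \sum_(w <- [:: 1; -1; 'i; - 'i]) purity (rdm (U *m y i k w)).
    by apply: eq_bigr => w _; rewrite /y -scalemxAr mulmxDr -scalemxAr.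
  exact: (etrans (arith _ _ _) (congr1 (fun t => _ + (_ + _ * t)) sumE)).
have lK i k q : q \in l i k -> q.2 \in K /\ dot q.2 q.2 = 1.
  rewrite /l; have [_|ik] := eqVneq i k.
    by rewrite mem_seq1 => /eqP->; split; [exact: eK|exact: e1].
  rewrite 2!in_cons => /or3P[/eqP->|/eqP->|/mapP[w wl ->]]; first by split; [exact: eK|exact: e1].
    by split; [exact: eK|exact: e1].
  by split; [exact: yK|apply: y1 => //; exact: ws].
have lE i k : \sum_(q <- l i k) q.1 = 1 + (i == k)%:R.
  rewrite /l; case: eqP => [_|_]; first by rewrite big_seq1.
  by rewrite !big_cons big_nil /=; field.
have aF i k := (Ex_vec_lin vec_mfun_purity purity_rdm_bound xK x1 (lK i k)).1.
have EF i k := (Ex_vec_lin vec_mfun_purity purity_rdm_bound xK x1 (lK i k)).2.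
have total : purity (ptrace2 (orthoproj K)) + purity (ptrace1 (orthoproj K)) =
    (D%:R * (D%:R + 1)) * E.
  rewrite -[LHS](Ex_cst K mu).
  rewrite (@Ex_ext _ _ _ _ _ (fun U =>
    \sum_i \sum_k \sum_(q <- l i k) q.1 * purity (rdm (U *m q.2)))); last first.
    move=> U GU; rewrite -(sum_pairs_const GU eP).
    by apply: eq_bigr => i _; apply: eq_bigr => k _; rewrite -FE.
  rewrite Ex_sum => [|i]; last by apply: admissible_sum => k; exact: aF.
  under eq_bigr => i _ do rewrite Ex_sum//.
  under eq_bigr => i _ do under eq_bigr => k _ do rewrite EF lE.
  have row (i : 'I_D) : \sum_k (1 + (i == k)%:R) * E = (D%:R + 1) * E.
    rewrite -mulr_suml big_split /= sumr_const card_ord; congr ((_ + _) * _).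
    rewrite (bigD1 i)//= eqxx big1 ?addr0// => k ki.
    by rewrite eq_sym (negPf ki).
  under eq_bigr => i _ do rewrite row.
  by rewrite sumr_const card_ord -[LHS]mulr_natl mulrA.
have DR : (D%:R : R) != 0 by rewrite pnatr_eq0 -lt0n.
have DR1 : (D%:R + 1 : R) != 0 by rewrite natr1 pnatr_eq0.
have OE : Omega K = ofR D%:R^-1 *: orthoproj K.
  by rewrite /Omega fmorphV rmorph_nat.
rewrite OE ptrace2Z ptrace1Z !purityZ -mulrDr total -/E.
by field; rewrite DR DR1.
Qed.

End PurityMean.

(** * Concentration of the truncated entropy *)

Section Concentration.
Variables (R : realType) (m n : nat) (K : {vspace 'cV[Cx R]_(m * n)}).
Variables (mu : probability (borelM R (m * n)) R) (haar_mu : is_haar K mu).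
Local Notation C := (Cx R).
Local Notation G := (unitary_group K).
Local Notation D := (\dim K).
Implicit Types (a b c phi : 'cV[C]_(m * n)).

(** The exponential moment of a Rademacher sum: the sum over signs factors into one hyperbolic
    cosine per coordinate. *)
Lemma sum_signs_le p (y : 'I_p -> R) :
  \sum_(s : {ffun 'I_p -> bool}) expR (\sum_i (-1) ^+ s i * y i) <=
  2 ^+ p * expR (\sum_i y i ^+ 2 / 2).
Proof.
under eq_bigr => s _ do rewrite expR_sum.
rewrite -(bigA_distr_bigA (fun i (b : bool) => expR ((-1) ^+ b * y i))).
rewrite expR_sum -[in 2 ^+ p](card_ord p) -prodr_const -big_split /=.
apply: ler_prod => i _; rewrite big_bool /= mulN1r mul1r.
rewrite addr_ge0 ?expR_ge0//=.
by have := cosh_le (y i); lra.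
Qed.

(** The coordinate [i0] belongs to the base point [a] and is set to zero to keep the combination
    orthogonal to it; the other p - 1 coordinates share the unit norm equally. *)
Definition sign_vec p (i0 : 'I_p) (s : {ffun 'I_p -> bool}) (i : 'I_p) : R :=
  if i == i0 then 0 else (-1) ^+ s i / Num.sqrt p.-1%:R.

Lemma sum_sign_vec p (i0 : 'I_p) s : (1 < p)%N -> \sum_i sign_vec i0 s i ^+ 2 = 1.
Proof.
move=> p1; have p0 : 0 < p.-1%:R :> R by rewrite ltr0n -ltnS prednK// ltnW.
rewrite (bigD1 i0)//= {1}/sign_vec eqxx expr0n add0r.
rewrite (eq_bigr (fun=> p.-1%:R^-1)) => [|i /negPf ii]; last first.
  by rewrite /sign_vec ii expr_div_n sqrr_sign sqr_sqrtr ?div1r// ltW.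
rewrite (eq_bigl (fun i => i \in predC1 i0))// sumr_const cardC1 card_ord.
by rewrite -[LHS]mulr_natl mulfV// gt_eqF.
Qed.

Lemma sum_exp_sign_vec_le p (i0 : 'I_p) (r : 'I_p -> R) (k : R) : (1 < p)%N ->
  \sum_s expR (2 * k * \sum_i sign_vec i0 s i * r i) <=
  2 ^+ p * expR (2 * k ^+ 2 / p.-1%:R * \sum_i r i ^+ 2).
Proof.
move=> p1; have p0 : 0 < p.-1%:R :> R by rewrite ltr0n -ltnS prednK// ltnW.
pose y i : R := if i == i0 then 0 else 2 * k * r i / Num.sqrt p.-1%:R.
have dy s : 2 * k * (\sum_i sign_vec i0 s i * r i) = \sum_i (-1) ^+ s i * y i.
  rewrite mulr_sumr; apply: eq_bigr => i _; rewrite /y /sign_vec.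
  by case: eqP => _; [rewrite !(mulr0, mul0r)|ring].
under eq_bigr => s _ do rewrite dy.
apply: le_trans (sum_signs_le y) _.
rewrite ler_wpM2l ?exprn_ge0// ler_expR mulr_sumr; apply: ler_sum => i _.
rewrite /y; case: eqP => _.
  by rewrite expr0n mul0r mulr_ge0 ?sqr_ge0// divr_ge0 ?(ltW p0)// mulr_ge0 ?sqr_ge0.
rewrite expr_div_n !exprMn sqr_sqrtr ?(ltW p0)//.
suff -> : 2 ^+ 2 * k ^+ 2 * r i ^+ 2 / p.-1%:R / 2 =
  2 * k ^+ 2 / p.-1%:R * r i ^+ 2 by [].
by field; rewrite gt_eqF.
Qed.

Lemma bessel p q (e : 'I_p -> 'cV[C]_q) (v : 'cV[C]_q) :
  (forall i j, dot (e i) (e j) = (i == j)%:R) ->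
  \sum_i re (dot v (e i)) ^+ 2 <= nsqv v.
Proof.
move=> ee; pose r i := re (dot v (e i)).
have arith (x y : R) : 0 <= x - y - (y - y) -> y <= x by lra.
have [w dw] : exists w, forall u, dot u w = \sum_i ofR (r i) * dot u (e i).
  exists (\sum_i ofR (r i) *: e i) => u.
  by rewrite dot_sumr; apply: eq_bigr => i _; rewrite dotZr.
have S0 : 0 <= nsqv (v - w) by apply: sumr_ge0 => k _; exact: nsq_ge0.
have vw : re (dot v w) = \sum_i r i ^+ 2.
  by rewrite dw raddf_sum; apply: eq_bigr => i _; rewrite /= re_ofRM expr2.
have reB (x y : C) : re (x - y) = re x - re y by rewrite (raddfB (@re R)).
have wv : re (dot w v) = \sum_i r i ^+ 2 by rewrite dotC re_conj.
have ww : re (dot w w) = \sum_i r i ^+ 2.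
  rewrite dw raddf_sum; apply: eq_bigr => i _ /=; rewrite re_ofRM dotC re_conj dw.
  rewrite (bigD1 i)//= ee eqxx mulr1 big1 => [|k ki].
    by rewrite addr0 re_ofR expr2.
  by rewrite ee eq_sym (negPf ki) mulr0.
have := S0; rewrite -[nsqv (v - w)]re_ofR -dot_nsqv dotBl !dotBr.
rewrite 3!reB wv vw ww (dot_nsqv v) re_ofR.
exact: arith.
Qed.

Lemma dim_gt1 a c : a \in K -> c \in K -> dot a a = 1 -> dot c c = 1 ->
  dot a c = 0 -> (1 < D)%N.
Proof.
move=> aK cK a1 c1 ac; rewrite ltnNge; apply/negP => D1.
have [e [eK ee eP]] := orthonormal_basis K.
have i0 := Ordinal (dim_gt0 aK a1).
have allE (i : 'I_D) : i = i0.
  apply/val_inj; case: i i0 => i hi [j hj] /=.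
  by move: (leq_trans hi D1) (leq_trans hj D1); case: i {hi} => //; case: j {hj}.
have E v : v \in K -> v = dot (e i0) v *: e i0.
  move/mem_orthoproj => {1}<-; rewrite -eP mulmx_suml (bigD1 i0)//= big1.
    by rewrite addr0 mulmx_outer.
  by move=> i; rewrite (allE i) eqxx.
move: a1 c1 ac; rewrite (E a aK) (E c cK) !dotZl !dotZr ee eqxx !mulr1.
move=> h1 h2 /eqP; rewrite mulf_eq0 => /orP[]/eqP h.
  by move: h1; rewrite h mul0r => /esym/eqP; rewrite oner_eq0.
by move: h2; rewrite h mulr0 => /esym/eqP; rewrite oner_eq0.
Qed.

Variable N : nat.
Local Notation f := (entN N).

Lemma entN_norm_le phi : unit_vector phi -> `|f phi| <= m%:R.
Proof.
move=> u; have x0 i := eig_rdm_ge0 phi i; have x1 i := eig_rdm_le1 i u.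
rewrite ger0_norm; last first.
  apply: sumr_ge0 => i _; apply: le_trans (eta_ge N (x0 i) (x1 i)).
  by rewrite -mulrN mulr_ge0// oppr_ge0 ln_le0.
rewrite -[X in _ <= X%:R](card_ord m) -sum1_card natr_sum; apply: ler_sum => i _.
have arith (x y : R) : 0 <= x -> y <= 0 - 0 + (x - 1) * (0 - 1) -> y <= 1 by lra.
(* The tangent at 1, where [eta] vanishes with slope -1, bounds [eta N y] by 1 - y. *)
have := @eta_tangent R N 1 (eig (rdm phi) i) (lexx 1) (x1 i).
have := x0 i; rewrite /deta logser1 {2}/eta subrr big1 => [|k _].
  exact: arith.
by rewrite expr0n mul0r.
Qed.

Lemma admissible_entN a : dot a a = 1 -> admissible K (fun U => f (U *m a)).
Proof.
apply: (@admissible_vec _ _ _ _ _ m%:R); last exact: entN_norm_le.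
by move=> d T Z mZ; exact: measurable_entN.
Qed.

Definition expdiff (lam : R) a b (U : 'M[C]_(m * n)) : R :=
  expR (lam * (f (U *m b) - f (U *m a))).

Lemma admissible_expdiff lam a b : dot a a = 1 -> dot b b = 1 ->
  admissible K (expdiff lam a b).
Proof.
move=> a1 b1; apply: admissible_exp.
apply: admissibleM; first exact: admissible_cst.
apply: admissibleD; first exact: admissible_entN.
rewrite (_ : (fun U => - _) = fun U => (-1) * f (U *m a)).
  by apply: admissibleM; [exact: admissible_cst|exact: admissible_entN].
by apply/funext => U; rewrite mulN1r.
Qed.

Lemma dot_rot a c (co si : R) : dot a a = 1 -> dot c c = 1 -> dot a c = 0 ->
  co ^+ 2 + si ^+ 2 = 1 ->
  dot (ofR co *: a + ofR si *: c) (ofR co *: a + ofR si *: c) = 1.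
Proof.
move=> a1 c1 ac cs.
have ca : dot c a = 0 by rewrite dotC ac rmorph0.
rewrite dotDl !dotDr !dotZl !dotZr a1 c1 ac ca !conj_ofR !mulr0 addr0 add0r !mulr1.
by rewrite -!rmorphM -rmorphD -!expr2 cs rmorph1.
Qed.

Let L := 3 + 4 * ln (max_rank K)%:R ^+ 2 : R.

(** The unitary taking [c] to [c'] fixes [a], so right invariance under it replaces [c] by [c']
    without moving the base point. *)
Lemma Ex_expdiff_orth a c c' (co si lam : R) : a \in K -> c \in K -> c' \in K ->
  dot a a = 1 -> dot c c = 1 -> dot c' c' = 1 -> dot a c = 0 -> dot a c' = 0 ->
  co ^+ 2 + si ^+ 2 = 1 ->
  Ex K mu (expdiff lam a (ofR co *: a + ofR si *: c)) =
  Ex K mu (expdiff lam a (ofR co *: a + ofR si *: c')).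
Proof.
move=> aK cK cK' a1 c1 c1' ac ac' cs.
have ca : dot c a = 0 by rewrite dotC ac rmorph0.
have ca' : dot c' a = 0 by rewrite dotC ac' rmorph0.
have [W [GW Wc Wa]] := unitary_group_trans cK cK' c1 c1'.
have Wx : W *m (ofR co *: a + ofR si *: c) = ofR co *: a + ofR si *: c'.
  by rewrite mulmxDr -!scalemxAr Wc (Wa a ca ca').
have adm := admissible_expdiff lam a1 (dot_rot a1 c1 ac cs).
apply: etrans (esym (Ex_right haar_mu adm GW)) _; apply: Ex_ext => U _.
by rewrite /expdiff -!mulmxA Wx (Wa a ca ca').
Qed.

(* By invariance [c] may be replaced by the average, over random signs, of
   normalized sums of basis vectors orthogonal to [a]: to first order the
   entropy difference is then a Rademacher sum. *)
Lemma Ex_step a c (co si lam : R) : a \in K -> c \in K ->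
  dot a a = 1 -> dot c c = 1 -> dot a c = 0 -> co ^+ 2 + si ^+ 2 = 1 -> 0 <= lam ->
  Ex K mu (expdiff lam a (ofR co *: a + ofR si *: c)) <=
  expR (lam * (2 * N.+1%:R * si ^+ 2) + 2 * (lam * (co * si)) ^+ 2 * L / D.-1%:R).
Proof.
move=> aK cK a1 c1 ac cs lam0.
have D1 := dim_gt1 aK cK a1 c1 ac.
have p0 : 0 < D.-1%:R :> R by rewrite ltr0n -ltnS prednK// ltnW.
have [e [i0 [eK ee ei0]]] := orthonormal_basis_from aK a1.
pose q := sign_vec i0.
have [cv [cvK acv cv1 cvU]] : exists cv : {ffun 'I_D -> bool} -> 'cV[C]_(m * n),
  [/\ forall s, cv s \in K, forall s, dot a (cv s) = 0,
      forall s, dot (cv s) (cv s) = 1 &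
      forall (s : {ffun 'I_D -> bool}) (g : 'cV[C]_(m * n)) (U : 'M[C]_(m * n)),
        re (dot g (U *m cv s)) = \sum_i q s i * re (dot g (U *m e i))].
  exists (fun s => \sum_i ofR (q s i) *: e i).
  have dcv u s : dot u (\sum_i ofR (q s i) *: e i) = \sum_i ofR (q s i) * dot u (e i).
    by rewrite dot_sumr; apply: eq_bigr => i _; rewrite dotZr.
  have ecv i s : dot (e i) (\sum_i ofR (q s i) *: e i) = ofR (q s i).
    rewrite dcv (bigD1 i)//= ee eqxx mulr1 big1 ?addr0// => k ki.
    by rewrite ee eq_sym (negPf ki) mulr0.
  split=> s.
  - by apply: memv_suml => i _; exact: memvZ.
  - by rewrite -ei0 ecv /q /sign_vec eqxx rmorph0.
  - rewrite dcv; transitivity (ofR (\sum_i q s i ^+ 2)).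
      rewrite (rmorph_sum (@ofR R)); apply: eq_bigr => i _.
      by rewrite dotC ecv conj_ofR expr2 rmorphM.
    by rewrite sum_sign_vec// rmorph1.
  - move=> g U; rewrite mulmx_sumr dot_sumr raddf_sum; apply: eq_bigr => i _.
    by rewrite /= -scalemxAr dotZr re_ofRM.
set k := lam * (co * si).
set A := lam * (2 * N.+1%:R * si ^+ 2).
set B := 2 * k ^+ 2 * L / D.-1%:R.
have adm s := admissible_expdiff lam a1 (dot_rot a1 (cv1 s) (acv s) cs).
have main U : G U -> \sum_(s : {ffun 'I_D -> bool})
    expdiff lam a (ofR co *: a + ofR si *: cv s) U <= 2 ^+ D * expR (A + B).
  move=> GU; have UU u v := unitary_group_dot u v GU.
  have [r rE] : exists r : 'I_D -> R, forall i,
      re (dot (entgrad N (U *m a)) (U *m e i)) = r i by eexists.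
  have arith (x z t v : R) : x <= z + 2 * (co * si) * t + 2 * v * si ^+ 2 ->
      lam * (x - z) <= lam * (2 * v * si ^+ 2) + 2 * k * t.
    rewrite -!addrA -lerBlDl => /(ler_wpM2l lam0); rewrite /k; lra.
  have step s : expdiff lam a (ofR co *: a + ofR si *: cv s) U <=
      expR A * expR (2 * k * \sum_i q s i * r i).
    rewrite -expRD /expdiff ler_expR.
    have xE : U *m (ofR co *: a + ofR si *: cv s) =
        ofR co *: (U *m a) + ofR si *: (U *m cv s).
      by rewrite mulmxDr -!scalemxAr.
    have uchi : unit_vector (ofR co *: (U *m a) + ofR si *: (U *m cv s)).
      by apply: unit_dot; rewrite -xE UU dot_rot.
    have := entN_step N (unit_dot (etrans (UU a a) a1))
      (unit_dot (etrans (UU (cv s) (cv s)) (cv1 s))) uchi cs.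
    rewrite cvU xE; under eq_bigr => i _ do rewrite rE.
    exact: arith.
  apply: (@le_trans _ _ (\sum_(s : {ffun 'I_D -> bool})
      expR A * expR (2 * k * \sum_i q s i * r i))).
    by apply: ler_sum => s _; exact: step.
  rewrite -mulr_sumr [expR (A + B)]expRD [leRHS]mulrCA.
  apply: ler_wpM2l; first exact: expR_ge0.
  apply: le_trans (sum_exp_sign_vec_le i0 r k D1) _.
  rewrite ler_wpM2l ?exprn_ge0// ler_expR.
  have rL : \sum_i r i ^+ 2 <= L.
    under eq_bigr => i _ do rewrite -rE.
    apply: le_trans (bessel _ _) _ => [i j|]; first by rewrite UU ee.
    apply: nsqv_entgrad_le; first exact: unitary_group_mem.
    by apply: unit_dot; rewrite UU.
  have -> : B = 2 * k ^+ 2 / D.-1%:R * L by rewrite /B mulrAC.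
  apply: ler_wpM2l rL.
  by rewrite divr_ge0 ?(ltW p0)// mulr_ge0 ?sqr_ge0.
have pow2 : 0 < 2 ^+ D :> R by rewrite exprn_gt0.
rewrite -(ler_pM2l pow2) -[leRHS](Ex_cst K mu).
have -> : 2 ^+ D * Ex K mu (expdiff lam a (ofR co *: a + ofR si *: c)) =
    Ex K mu (fun U => \sum_(s : {ffun 'I_D -> bool})
      expdiff lam a (ofR co *: a + ofR si *: cv s) U).
  rewrite Ex_sum//; under eq_bigr => s _ do
    rewrite -(Ex_expdiff_orth lam aK cK (cvK s) a1 c1 (cv1 s) ac (acv s) cs).
  by rewrite sumr_const card_ffun card_bool card_ord -[RHS]mulr_natl natrX.
apply: Ex_le => //; [exact: admissible_sum|exact: admissible_cst].
Qed.

Lemma expR_mean_le I (r : seq I) (z : I -> R) k : 0 < k -> k = (size r)%:R ->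
  expR ((\sum_(j <- r) z j) / k) <= (\sum_(j <- r) expR (z j)) / k.
Proof.
move=> k0 kE; set mean := _ / k.
rewrite ler_pdivlMr//.
have -> : expR mean * k = \sum_(j <- r) (expR mean * (1 + (z j - mean))).
  rewrite -mulr_sumr big_split /= sumrB !big_const_seq count_predT !iter_addr_0.
  rewrite -[1 *+ _]/(_%:R) -kE -[mean *+ _]mulr_natr -kE {3}/mean mulfVK ?gt_eqF//.
  by rewrite subrr addr0.
apply: ler_sum => j _.
rewrite -[in leRHS](subrKC mean (z j)) expRD ler_wpM2l ?expR_ge0//.
exact: expR_ge1Dx.
Qed.

Lemma expR_le_of_invn (x p q : R) : 0 <= p ->
  (forall k, x <= expR (p / k.+1%:R + q)) -> x <= expR q.
Proof.
move=> p0 h; rewrite leNgt; apply/negP => qx.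
have x0 : 0 < x := lt_trans (expR_gt0 q) qx.
have d0 : 0 < ln x - q by rewrite subr_gt0 -ltr_expR lnK.
pose k := Num.bound (p / (ln x - q)).
have hk : p / (ln x - q) < k.+1%:R.
  apply: lt_le_trans (_ : k%:R <= _); last by rewrite ler_nat.
  by rewrite archi_boundP// divr_ge0// ltW.
have := h k; rewrite leNgt => /negP; apply.
rewrite -[x in ltRHS]lnK// ltr_expR -ltrBrDr ltr_pdivrMr ?ltr0n//.
by rewrite mulrC -ltr_pdivrMr.
Qed.

(** The total difference is the mean of k + 1 increments, each enlarged k + 1 times; convexity of
    exp bounds the exponential of the mean by the mean of exponentials. No independence of the
    increments is required. *)
Lemma Ex_chain (x : nat -> 'cV[C]_(m * n)) k (lam B : R) :
  (forall j, dot (x j) (x j) = 1) ->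
  (forall j, Ex K mu (expdiff (k.+1%:R * lam) (x j) (x j.+1)) <= B) ->
  Ex K mu (expdiff lam (x 0%N) (x k.+1)) <= B.
Proof.
move=> x1 xB; set K' : R := k.+1%:R in xB; have K0 : 0 < K' by rewrite ltr0n.
have adm j := admissible_expdiff (K' * lam) (x1 j) (x1 j.+1).
have asum : admissible K (fun U => \sum_(j < k.+1) expdiff (K' * lam) (x j) (x j.+1) U).
  by apply: admissible_sum => j; exact: adm.
have arith (d : R) : lam * d = (K' * lam * d) / K'.
  by rewrite -(mulrA K') [K' * _]mulrC mulfK// gt_eqF.
apply: (@le_trans _ _ (Ex K mu (fun U => K'^-1 *
    \sum_(j < k.+1) expdiff (K' * lam) (x j) (x j.+1) U))).
  apply: Ex_le; first exact: (admissible_expdiff lam (x1 0%N) (x1 k.+1)).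
    by apply: admissibleM asum; exact: admissible_cst.
  move=> U _; have [g gE] : exists g : nat -> R, forall j, f (U *m x j) = g j by eexists.
  rewrite /expdiff 2!gE; under eq_bigr => j _ do rewrite 2!gE.
  rewrite -(telescope_sumr g (leq0n k.+1)).
  rewrite arith mulr_sumr big_mkord [leRHS]mulrC.
  by apply: expR_mean_le K0 _; rewrite /K' /index_enum -enumT size_enum_ord.
rewrite (ExZ mu _ asum) Ex_sum => [|j]; last exact: adm.
rewrite mulrC ler_pdivrMr//.
have -> : B * K' = \sum_(j < k.+1) B by rewrite sumr_const card_ord -[RHS]mulr_natr.
by apply: ler_sum => j _; exact: xB.
Qed.

(** With steps of angle [theta / k.+1] and multiplier [k.+1 * lam], the variance term is at most its
    value at (lam theta)^2 for every k, while the second-order term is at most [P / k.+1] and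
    disappears through [expR_le_of_invn]. *)
Lemma Ex_path a c (theta lam : R) : a \in K -> c \in K ->
  dot a a = 1 -> dot c c = 1 -> dot a c = 0 -> 0 <= theta -> theta <= pi / 2 -> 0 <= lam ->
  Ex K mu (expdiff lam a (ofR (cos theta) *: a + ofR (sin theta) *: c)) <=
  expR (2 * (lam * theta) ^+ 2 * L / D.-1%:R).
Proof.
move=> aK cK a1 c1 ac th0 thpi lam0.
have ca : dot c a = 0 by rewrite dotC ac rmorph0.
have D1 := dim_gt1 aK cK a1 c1 ac.
have p0 : 0 < D.-1%:R :> R by rewrite ltr0n -ltnS prednK// ltnW.
have L0 : 0 <= L by rewrite addr_ge0// mulr_ge0// sqr_ge0.
pose P : R := lam * (2 * N.+1%:R) * theta ^+ 2.
apply: (@expR_le_of_invn _ P) => [|k]; first by rewrite !mulr_ge0// sqr_ge0.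
pose K' : R := k.+1%:R; have K0 : 0 < K' by rewrite ltr0n.
pose del := theta / K'.
have del0 : 0 <= del by rewrite divr_ge0// ltW.
have delth : del <= theta.
  by rewrite ler_pdivrMr// ler_peMr// ler1n.
have s0 : 0 <= sin del.
  apply: sin_ge0_pi; rewrite del0 (le_trans delth)// (le_trans thpi)//.
  by rewrite ler_pdivrMr// ler_peMr ?ler1n// pi_ge0.
have s1 : sin del ^+ 2 <= del ^+ 2 by rewrite ler_sqr ?nnegrE// sin_le_id.
have cs1 : (cos del * sin del) ^+ 2 <= del ^+ 2.
  by rewrite exprMn; apply: le_trans s1; rewrite ler_piMl ?sqr_ge0//.
have Kl0 : 0 <= K' * lam by rewrite mulr_ge0// ltW.
have bound : K' * lam * (2 * N.+1%:R * sin del ^+ 2) +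
    2 * (K' * lam * (cos del * sin del)) ^+ 2 * L / D.-1%:R <=
    P / K' + 2 * (lam * theta) ^+ 2 * L / D.-1%:R.
  apply: lerD.
    have -> : P / K' = K' * lam * (2 * N.+1%:R * del ^+ 2).
      rewrite /P /del; move: (N.+1%:R) => v; field; exact: lt0r_neq0.
    by rewrite ler_wpM2l// ler_wpM2l.
  rewrite ler_wpM2r ?invr_ge0 ?(ltW p0)// ler_wpM2r// ler_wpM2l//.
  have -> : lam * theta = K' * lam * del by rewrite /del; field; exact: lt0r_neq0.
  by rewrite (exprMn _ (K' * lam) del) (exprMn _ (K' * lam)) ler_wpM2l ?sqr_ge0.
(* Points of the great circle through [a] and [c], with unit tangents [y]: each point arises from
   its predecessor by the same small rotation towards the tangent, so [Ex_step] applies along the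
   whole path. *)
pose x (j : nat) := ofR (cos (j%:R * del)) *: a + ofR (sin (j%:R * del)) *: c.
pose y (j : nat) := ofR (- sin (j%:R * del)) *: a + ofR (cos (j%:R * del)) *: c.
have xK j : x j \in K by rewrite memvD ?memvZ.
have yK j : y j \in K by rewrite memvD ?memvZ.
have x1 j : dot (x j) (x j) = 1 by apply: dot_rot => //; exact: cos2Dsin2.
have y1 j : dot (y j) (y j) = 1.
  by apply: dot_rot => //; rewrite sqrrN addrC cos2Dsin2.
have xy j : dot (x j) (y j) = 0.
  rewrite dotDl !dotDr !dotZl !dotZr a1 c1 ac ca !conj_ofR !mulr0 addr0 add0r !mulr1.
  by rewrite -!rmorphM -rmorphD mulrN mulrC addNr rmorph0.
have xS j : x j.+1 = ofR (cos del) *: x j + ofR (sin del) *: y j.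
  rewrite /y !scalerDr !scalerA -!rmorphM addrACA -!scalerDl -!rmorphD mulrN.
  rewrite -cosD /x -[j.+1%:R]natr1 mulrDl mul1r [_ + del]addrC.
  by rewrite sinD [sin del * _ + _]addrC.
have x0 : x 0%N = a.
  by rewrite /x mul0r cos0 sin0 rmorph1 rmorph0 scale1r scale0r addr0.
have xk : x k.+1 = ofR (cos theta) *: a + ofR (sin theta) *: c.
  by rewrite /x /del mulrC mulfVK// gt_eqF.
rewrite -xk -{1}x0.
apply: (Ex_chain x1) => j; rewrite -/K'.
rewrite xS; apply: le_trans (Ex_step (xK j) (yK j) (x1 j) (y1 j) (xy j) (cos2Dsin2 del) Kl0) _.
by rewrite ler_expR.
Qed.

Lemma entN_phase (w : C) a : w^* * w = 1 -> f (w *: a) = f a.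
Proof.
move=> ww; rewrite /entN; suff -> : rdm (w *: a) = rdm a by [].
rewrite !rdmE tensor_mxZ adjZ -scalemxAl -scalemxAr scalerA.
by rewrite [w * _]mulrC ww scale1r.
Qed.

Lemma acos_le_pihalf (r : R) : 0 <= r -> r <= 1 -> acos r <= pi / 2.
Proof.
move=> r0 r1; have rb : -1 <= r <= 1 by rewrite r1 andbT (le_trans _ r0)// lerN10.
have [_ cr] := acos_def rb; have h := acos_lepi rb.
rewrite leNgt; apply/negP => hlt; have := r0; rewrite leNgt => /negP; apply.
rewrite -cr -(subrK (pi / 2) (acos r)) cosDpihalf oppr_lt0.
have pi0 := pi_gt0 R.
by apply: sin_gt0_pi; apply/andP; split; lra.
Qed.

(* [Ex_path] gives [pi^2 L / (2 (D - 1))] for [D >= 2]; the factor 3 turns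
   [D - 1] into [D + 1] and covers [D = 1], where [b] is a phase times [a]. *)
Let V := 3 * pi ^+ 2 * L / (2 * (D%:R + 1)) : R.

Lemma Ex_pair a b (lam : R) : a \in K -> b \in K -> dot a a = 1 -> dot b b = 1 ->
  0 <= lam -> Ex K mu (expdiff lam a b) <= expR (lam ^+ 2 * V).
Proof.
move=> aK bK a1 b1 lam0.
have L0 : 0 <= L by rewrite addr_ge0// mulr_ge0// sqr_ge0.
have V0 : 0 <= V.
  have pi2 : 0 <= 3 * pi ^+ 2 :> R by apply: mulr_ge0 => //; exact: sqr_ge0.
  have D2 : 0 <= 2 * (D%:R + 1) :> R by apply: mulr_ge0 => //; exact: addr_ge0.
  exact: divr_ge0 (mulr_ge0 pi2 L0) D2.
set z := dot a b; set r : R := Num.sqrt (nsq z).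
have r0 : 0 <= r by exact: sqrtr_ge0.
have r2 : r ^+ 2 = nsq z by rewrite sqr_sqrtr// nsq_ge0.
(* The entropy ignores phases. Making the inner product real and nonnegative puts the new vector at
   angle at most pi/2 from [a] on a real great circle. *)
have [w [ww wz]] : exists w : C, w^* * w = 1 /\ w * z = ofR r.
  have [z0|z0] := eqVneq z 0.
    exists 1; rewrite conjC1 mulr1; split=> //.
    by rewrite mul1r /r z0 /nsq (raddf0 (@re R)) (raddf0 (@im R)) expr0n addr0 sqrtr0 rmorph0.
  have rn0 : r != 0.
    by apply: contra z0 => /eqP r00; apply/eqP/nsq_eq0; rewrite -r2 r00 expr0n.
  exists (ofR r^-1 * z^*); split.
    rewrite rmorphM /= conjCK conj_ofR mulrACA -rmorphM mulz_conj -r2 -rmorphM.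
    by rewrite -expr2 -exprMn mulVf// expr1n rmorph1.
  by rewrite -mulrA [z^* * z]mulrC mulz_conj -rmorphM -r2 expr2 mulrA mulVf// mul1r.
pose b' := w *: b.
have bK' : b' \in K by exact: memvZ.
have b1' : dot b' b' = 1 by rewrite dotZl dotZr b1 mulr1.
have ab' : dot a b' = ofR r by rewrite dotZr.
have ba' : dot b' a = ofR r by rewrite dotC ab' conj_ofR.
have -> : Ex K mu (expdiff lam a b) = Ex K mu (expdiff lam a b').
  by apply: Ex_ext => U _; rewrite /expdiff -[U *m b']scalemxAr entN_phase.
clearbody b'.
have nv : nsqv (b' - ofR r *: a) = 1 - r ^+ 2.
  apply: ofR_inj; rewrite -dot_nsqv dotBl !dotBr !dotZl !dotZr b1' a1 ab' ba'.
  by rewrite conj_ofR mulr1 subrr subr0 rmorphB rmorph1 expr2 rmorphM.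
have nv0 : 0 <= 1 - r ^+ 2 by rewrite -nv; apply: sumr_ge0 => i _; exact: nsq_ge0.
have r1 : r <= 1 by rewrite -(@ler_pXn2r _ 2) ?nnegrE// expr1n -subr_ge0.
(* If [b'] coincides with [a], there is no second direction [c] to rotate towards; this includes
   [D = 1]. *)
have [re1|rn1] := eqVneq (1 - r ^+ 2) 0.
  have b'a : b' = a.
    have re1' : r = 1.
      by apply/eqP; rewrite -(@eqrXn2 _ 2)// expr1n eq_sym -subr_eq0 re1.
    apply/eqP; rewrite -subr_eq0; apply/eqP/dot_eq0.
    by move: nv; rewrite re1 re1' rmorph1 scale1r dot_nsqv => ->; rewrite rmorph0.
  rewrite b'a (_ : Ex K mu _ = 1).
    by rewrite -[leLHS]expR0 ler_expR mulr_ge0 ?sqr_ge0.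
  rewrite -[RHS](Ex_cst K mu); apply: Ex_ext => U _.
  by rewrite /expdiff subrr mulr0 expR0.
set s : R := Num.sqrt (1 - r ^+ 2).
have s2 : s ^+ 2 = 1 - r ^+ 2 by rewrite sqr_sqrtr.
have sn0 : s != 0 by rewrite -sqrf_eq0 s2.
pose c := ofR s^-1 *: (b' - ofR r *: a).
have cK : c \in K by rewrite memvZ// memvB// memvZ.
have c1 : dot c c = 1.
  rewrite dotZl dotZr dot_nsqv nv conj_ofR -s2 -!rmorphM mulrA -expr2.
  by rewrite -exprMn mulVf// expr1n rmorph1.
have ac : dot a c = 0 by rewrite dotZr dotBr dotZr a1 ab' mulr1 subrr mulr0.
have rb : -1 <= r <= 1 by rewrite r1 andbT (le_trans _ r0)// lerN10.
have b'E : b' = ofR (cos (acos r)) *: a + ofR (sin (acos r)) *: c.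
  rewrite (acos_def rb).2 (sin_acos rb) -/s scalerA -rmorphM divff// rmorph1 scale1r.
  by rewrite addrC subrK.
have th0 := acos_ge0 rb; have th1 := acos_le_pihalf r0 r1.
rewrite b'E; apply: le_trans (Ex_path aK cK a1 c1 ac th0 th1 lam0) _.
have D1 := dim_gt1 aK cK a1 c1 ac.
have D2 : 2 <= D%:R :> R by rewrite ler_nat.
have DE : D.-1%:R = D%:R - 1 :> R by rewrite -[X in X%:R - 1](prednK (ltnW D1)) -natr1 addrK.
rewrite ler_expR DE /V; move: (acos r) th0 th1 => t th0 th1.
have t2 : t ^+ 2 <= pi ^+ 2 / 4.
  have := pi_gt0 R; move: (pi : R) th1 => p; nra.
have d0 : 0 < (D%:R - 1 : R) by lra.
have d1 : (D%:R - 1 : R)^-1 <= 3 / (D%:R + 1).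
  rewrite ler_pdivlMr; last lra.
  by rewrite mulrC ler_pdivrMr//; lra.
have H : lam ^+ 2 * t ^+ 2 <= lam ^+ 2 * (pi ^+ 2 / 4) by rewrite ler_wpM2l ?sqr_ge0.
apply: (@le_trans _ _ (2 * (lam ^+ 2 * (pi ^+ 2 / 4)) * L * (3 / (D%:R + 1)))).
  apply: ler_pM => //; rewrite ?invr_ge0 ?(ltW d0)//.
    by rewrite !mulr_ge0 ?sqr_ge0.
  by rewrite ler_wpM2r// exprMn ler_wpM2l.
suff -> : 2 * (lam ^+ 2 * (pi ^+ 2 / 4)) * L * (3 / (D%:R + 1)) =
  lam ^+ 2 * (3 * pi ^+ 2 * L / (2 * (D%:R + 1))) by [].
move: (L) (pi : R) => l p; field; apply: lt0r_neq0; lra.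
Qed.

Lemma expR_Ex_le (z : 'M[C]_(m * n) -> R) : admissible K z ->
  expR (Ex K mu z) <= Ex K mu (fun U => expR (z U)).
Proof.
move=> az; set e := Ex K mu z.
have a1 : admissible K (fun U => (1 - e) + z U).
  by apply: admissibleD => //; exact: admissible_cst.
have -> : expR e = Ex K mu (fun U => expR e * ((1 - e) + z U)).
  rewrite (ExZ mu _ a1) (ExD mu (admissible_cst K _) az) Ex_cst -/e.
  by rewrite subrK mulr1.
apply: Ex_le; [|exact: admissible_exp|move=> U _].
  by apply: admissibleM => //; exact: admissible_cst.
rewrite -[in leRHS](subrKC e (z U)) expRD ler_wpM2l ?expR_ge0//.
by apply: le_trans (expR_ge1Dx _); rewrite addrAC addrA.
Qed.

Variable phi0 : 'cV[C]_(m * n).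
Hypotheses (phi0K : phi0 \in K) (phi01 : dot phi0 phi0 = 1).

Let m0 := Ex K mu (fun U => f (U *m phi0)).

(** By left invariance [m0] is the mean over W of [f (U *m W *m phi0)] for each fixed U. Jensen's
    inequality moves this mean outside the exponential; after exchanging the integrals, [Ex_pair]
    applies to [phi0] and [W *m phi0] with W fixed. *)
Lemma Ex_exp_deviation (lam : R) : 0 <= lam ->
  Ex K mu (fun U => expR (lam * (m0 - f (U *m phi0)))) <= expR (lam ^+ 2 * V).
Proof.
move=> lam0.
pose h (U W : 'M[C]_(m * n)) : R := expdiff lam phi0 (W *m phi0) U.
have fb U : G U -> `|f (U *m phi0)| <= m%:R.
  by move=> GU; apply: entN_norm_le; apply: unit_dot; rewrite (unitary_group_dot _ _ GU).
have af := admissible_entN phi01.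
have mh : mx_mfun2 h.
  move=> d T Z W mZ mW; rewrite /h /expdiff.
  apply: (measurableT_comp (@measurable_expR R)).
  apply: measurable_funM; first exact: measurable_cst.
  apply: measurable_funB; apply: measurable_entN; last exact: mx_measurable_mulmx.
  by apply: mx_measurableM => //; exact: mx_measurable_mulmx.
have mh' : mx_mfun2 (fun W U => h U W) by move=> d T Z W mZ mW; exact: mh.
have hM U W : G U -> G W -> `|h U W| <= expR (lam * (m%:R + m%:R)).
  move=> GU GW; rewrite ger0_norm ?expR_ge0// ler_expR ler_wpM2l//.
  apply: le_trans (ler_norm _) (le_trans (ler_normB _ _) _).
  by apply: lerD; [rewrite mulmxA; exact: fb (unitary_groupM GU GW)|exact: fb].
have hM' U W : G U -> G W -> `|h W U| <= expR (lam * (m%:R + m%:R)).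
  by move=> GU GW; exact: hM.
apply: (@le_trans _ _ (Ex K mu (fun U => Ex K mu (h U)))).
  apply: (Ex_Ex_ge mh hM) => [|U GU].
    apply: admissible_exp; apply: admissibleM; first exact: admissible_cst.
    apply: admissibleD; first exact: admissible_cst.
    rewrite (_ : (fun U => - _) = fun U => (-1) * f (U *m phi0)).
      by apply: admissibleM => //; exact: admissible_cst.
    by apply/funext => U; rewrite mulN1r.
  have aU : admissible K (fun W => f (U *m W *m phi0)) := admissible_left af GU.
  have aU' : admissible K (fun W => f (U *m W *m phi0) + (- f (U *m phi0))).
    by apply: admissibleD => //; exact: admissible_cst.
  have az : admissible K (fun W => lam * (f (U *m W *m phi0) - f (U *m phi0))).
    by apply: admissibleM => //; exact: admissible_cst.
  have -> : m0 - f (U *m phi0) = Ex K mu (fun W => f (U *m W *m phi0) - f (U *m phi0)).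
    by rewrite (ExD mu aU (admissible_cst K _)) Ex_cst (Ex_left haar_mu af GU).
  rewrite -(ExZ mu _ aU'); apply: le_trans (expR_Ex_le az) _.
  rewrite le_eqVlt; apply/orP; left; apply/eqP.
  by apply: Ex_ext => W _; rewrite /h /expdiff mulmxA.
rewrite (Ex_swap mu mh hM) -[leRHS](Ex_cst K mu).
apply: (Ex_Ex_le mh' hM') => [|W GW]; first exact: admissible_cst.
apply: Ex_pair => //; first exact: unitary_group_mem.
by rewrite (unitary_group_dot _ _ GW).
Qed.

Lemma entN_deviation (A : set (borelM R (m * n))) (t : R) : measurable A -> 0 < t ->
  (forall U, A U -> G U -> f (U *m phi0) <= m0 - t) ->
  (mu A <= (expR (- (t ^+ 2 / (4 * V))))%:E)%E.
Proof.
move=> mA t0 hA.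
have L0 : 0 < L by rewrite ltr_pwDl// mulr_ge0// sqr_ge0.
have V0 : 0 < V.
  have p0 := pi_gt0 R.
  by rewrite divr_gt0// ?mulr_gt0 ?exprn_gt0// ltr_wpDl.
(* The minimizer of lam^2 V - lam t. *)
pose lam := t / (2 * V); have lam0 : 0 <= lam := divr_ge0 (ltW t0) (mulr_ge0 (ler0n _ 2) (ltW V0)).
have af := admissible_entN phi01.
have ad : admissible K (fun U => expR (lam * (m0 - f (U *m phi0)))).
  apply: admissible_exp; apply: admissibleM; first exact: admissible_cst.
  apply: admissibleD; first exact: admissible_cst.
  rewrite (_ : (fun U => - _) = fun U => (-1) * f (U *m phi0)).
    by apply: admissibleM => //; exact: admissible_cst.
  by apply/funext => U; rewrite mulN1r.
pose g (U : 'M[C]_(m * n)) := expR (- (lam * t)) * expR (lam * (m0 - f (U *m phi0))).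
have ag : admissible K g by apply: admissibleM => //; exact: admissible_cst.
apply: (@le_trans _ _ (Ex K mu g)%:E).
  apply: (markov_Ex haar_mu mA ag) => [U _|U AU GU].
    by rewrite mulr_ge0 ?expR_ge0.
  rewrite /g -expRD -[leLHS]expR0 ler_expR -mulrN -mulrDr mulr_ge0//.
  by have := hA U AU GU; lra.
rewrite lee_fin /g (ExZ mu _ ad).
apply: (@le_trans _ _ (expR (- (lam * t)) * expR (lam ^+ 2 * V))).
  by rewrite ler_wpM2l ?expR_ge0// Ex_exp_deviation.
rewrite -expRD ler_expR /lam; move: (V) V0 => v v0.
suff -> : - (t / (2 * v) * t) + (t / (2 * v)) ^+ 2 * v = - (t ^+ 2 / (4 * v)) by [].
by field; rewrite gt_eqF.
Qed.

End Concentration.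

(** * Lower tail of the entanglement entropy *)

(** Five terms of the series at 1/2. The value 0.688 is precise enough for the case of rank 2 in
    [exponent_lt]. *)
Lemma ln2_ge (R : realType) : 86 / 125 <= ln 2 :> R.
Proof.
have h : 0 < 2^-1 :> R by rewrite invr_gt0.
have h1 : 2^-1 <= 1 :> R by lra.
have := logser_le_ln 5 h h1; rewrite lnV ?posrE// opprK; apply: le_trans.
by rewrite /logser !big_ord_recr big_ord0 /=; lra.
Qed.

Section LowerTail.
Variables (R : realType) (m n : nat) (K : {vspace 'cV[Cx R]_(m * n)}).
Variables (mu : probability (borelM R (m * n)) R) (haar_mu : is_haar K mu).
Variable phi0 : 'cV[Cx R]_(m * n).
Hypotheses (phi0K : phi0 \in K) (phi01 : dot phi0 phi0 = 1).
Local Notation G := (unitary_group K).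
Local Notation D := (\dim K).

(** A uniform positive bound passes to the expectation and makes the mean purity a legitimate
    argument of the logarithm. *)
Lemma purity_rdm_ge phi : unit_vector phi -> m%:R^-1 <= purity (rdm (phi : 'cV[Cx R]_(m * n))).
Proof.
move=> u; have s1 := sum_eig_rdm u.
have m0 : 0 < m%:R :> R.
  rewrite ltr0n lt0n; apply/eqP => mz; move: s1.
  rewrite big1 => [|i _]; first by move/esym/eqP; rewrite oner_eq0.
  by have := ltn_ord i; rewrite {2}mz.
rewrite purityE ?adj_rdm//.
have : \sum_i (2 / m%:R * eig (rdm phi) i - m%:R^-1 ^+ 2) <= \sum_i eig (rdm phi) i ^+ 2.
  apply: ler_sum => i _; move: (eig _ i) => x.
  by have := sqr_ge0 (x - m%:R^-1); move: (m%:R^-1) => y; nra.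
apply: le_trans; rewrite sumrB -mulr_sumr s1 sumr_const card_ord -[_ ^+ 2 *+ m]mulr_natl.
rewrite mulr1 expr2 mulrA mulfV ?gt_eqF//.
by move: (m%:R^-1) => y; lra.
Qed.

Lemma Ex_entN_ge N : ln 2 * Sbar K <= Ex K mu (fun U => entN N (U *m phi0)).
Proof.
set P := purity (ptrace2 (Omega K)) + purity (ptrace1 (Omega K)).
have EP := Ex_purity haar_mu phi0K phi01; rewrite -/P in EP.
set c := _ * P in EP.
have unitU U : G U -> unit_vector (U *m phi0).
  by move=> GU; apply: unit_dot; rewrite (unitary_group_dot _ _ GU).
have ap := admissible_vec K (@vec_mfun_purity R m n) (@purity_rdm_bound R m n) phi01.
have m0 : 0 < m%:R :> R.
  rewrite ltr0n lt0n; apply/eqP => mz.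
  have := sum_eig_rdm (unit_dot phi01); rewrite big1 => [|i _].
    by move/esym/eqP; rewrite oner_eq0.
  by have := ltn_ord i; rewrite {2}mz.
have c0 : 0 < c.
  apply: (@lt_le_trans _ _ m%:R^-1); first by rewrite invr_gt0.
  rewrite -EP -[leLHS](Ex_cst K mu); apply: Ex_le => //; first exact: admissible_cst.
  by move=> U GU; apply: purity_rdm_ge; exact: unitU.
have DR : 0 < D%:R :> R by rewrite ltr0n; exact: dim_gt0 phi0K phi01.
have DD : 0 < D%:R / (D%:R + 1) :> R by rewrite divr_gt0// ltr_wpDr.
have P0 : 0 < P by move: c0; rewrite /c pmulr_rgt0.
(* The factor D / (D + 1) of the mean purity is the 1 - 1 / (D + 1) in the second logarithm of
   [Sbar]. *)
have -> : ln 2 * Sbar K = - ln c.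
  rewrite /Sbar -/P /log2 /c lnM ?posrE//.
  have -> : 1 - 1 / (D%:R + 1) = D%:R / (D%:R + 1) :> R.
    by field; rewrite gt_eqF// ltr_wpDr.
  have ln2 : ln 2 != 0 :> R by rewrite gt_eqF// ln_gt0// ltr1n.
  by field.
have -> : - ln c = Ex K mu (fun U => (1 - ln c) + (- c^-1) * purity (rdm (U *m phi0))).
  have ap' : admissible K (fun U => (- c^-1) * purity (rdm (U *m phi0))).
    by apply: admissibleM => //; exact: admissible_cst.
  rewrite (ExD mu (admissible_cst K _) ap') Ex_cst (ExZ mu _ ap) EP mulNr mulVf ?gt_eqF//.
  by move: (ln c) => x; lra.
apply: Ex_le.
- apply: admissibleD; first exact: admissible_cst.
  by apply: admissibleM => //; exact: admissible_cst.
- exact: admissible_entN.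
move=> U GU; apply: le_trans (ent_entropy_le_entN N (unitU U GU)).
apply: le_trans (ent_entropy_ge_purity (unitU U GU) c0).
by rewrite mulNr [c^-1 * _]mulrC.
Qed.

(** The ratio of the right side to the left is 12 (19/20)^2 pi (ln 2)^3 r^2 / (3 + 4 r^2). It
    increases with r, and inserting pi >= 3 and ln 2 >= 86/125 still leaves it above 1 at r =
    86/125. *)
Lemma exponent_lt (e d r : R) : 0 < e -> 0 < d -> ln 2 <= r ->
  d * e ^+ 2 / (72 * pi ^+ 3 * ln 2 * r ^+ 2) <
  (19 / 20 * (ln 2 * e)) ^+ 2 / (4 * (3 * pi ^+ 2 * (3 + 4 * r ^+ 2) / (2 * d))).
Proof.
move=> e0 d0 rl; have l0 := ln2_ge R; have p0 := pi_ge3 R.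
move: (ln 2) (pi : R) l0 p0 rl => l p l0 p0 rl.
have lp : 0 < l by lra.
have pp : 0 < p by lra.
have rp : 0 < r by lra.
have r2 : (86 / 125) ^+ 2 <= r ^+ 2 by rewrite ler_sqr ?nnegrE//; lra.
have l3 : (86 / 125) ^+ 3 <= l ^+ 3 by rewrite lerXn2r ?nnegrE//; lra.
have pl : 3 * (86 / 125) ^+ 3 <= p * l ^+ 3.
  by apply: ler_pM => //; rewrite exprn_ge0//; lra.
have key : 3 + 4 * r ^+ 2 < 12 * (19 / 20) ^+ 2 * (p * l ^+ 3) * r ^+ 2.
  apply: (@lt_le_trans _ _ (12 * (19 / 20) ^+ 2 * (3 * (86 / 125) ^+ 3) * r ^+ 2)).
    by move: (r ^+ 2) r2 => x; lra.
  by rewrite ler_wpM2r ?sqr_ge0// ler_wpM2l.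
set q := 3 + 4 * r ^+ 2 in key *.
have q0 : 0 < q by rewrite ltr_pwDl// mulr_ge0// sqr_ge0.
have -> : (19 / 20 * (l * e)) ^+ 2 / (4 * (3 * p ^+ 2 * q / (2 * d))) =
  d * e ^+ 2 / (72 * p ^+ 3 * l * r ^+ 2) *
  (12 * (19 / 20) ^+ 2 * (p * l ^+ 3) * r ^+ 2 / q).
  by field; rewrite !gt_eqF.
rewrite ltr_pMr; first by rewrite ltr_pdivlMr// mul1r.
by rewrite divr_gt0// !mulr_gt0 ?exprn_gt0.
Qed.

Lemma ent_entropy_concentration (eps : R) : 0 < eps ->
  ((1 - expR (- ((D%:R + 1) * eps ^+ 2
                / (72 * pi ^+ 3 * ln 2 * ln (max_rank K)%:R ^+ 2))))%:E <
   mu [set U : 'M[Cx R]_(m * n) | (Sbar K - eps <= ent_entropy (U *m phi0))%R])%E.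
Proof.
move=> eps0; have l2 := ln2_ge R; have l0 : 0 < ln 2 :> R by lra.
set good := (X in (_ < mu X)%E).
have mgood : measurable (good : set (borelM R (m * n))).
  have mf : measurable_fun [set: borelM R (m * n)]
      (fun U : borelM R (m * n) => ent_entropy ((U : 'M[Cx R]_(m * n)) *m phi0)).
    by apply: measurable_ent_entropy; apply: mx_measurable_mulmx; exact: mx_measurable_id.
  have := mf measurableT _ (measurable_itv `[Sbar K - eps, +oo[).
  rewrite setTI; congr measurable; apply/seteqP; split => U /=.
    by rewrite in_itv /= andbT.
  by rewrite in_itv /= andbT.
have mbad := measurableC mgood.
(* The remaining twentieth of [ln 2 * eps], the deviation converted to nats, is reserved for the
   truncation error m / (N + 1). *)
pose t := 19 / 20 * (ln 2 * eps).
have le0 : 0 < ln 2 * eps by rewrite mulr_gt0.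
have t0 : 0 < t by rewrite mulr_gt0//; lra.
pose N := Num.bound (m%:R / (ln 2 * eps / 20)).
have hN : m%:R / N.+1%:R <= ln 2 * eps / 20.
  rewrite ler_pdivrMr ?ltr0n// mulrC -ler_pdivrMr; last by lra.
  apply: ltW; apply: lt_le_trans (_ : N%:R <= _); last by rewrite ler_nat.
  by rewrite archi_boundP// divr_ge0//; lra.
have dev : (mu (~` (good : set (borelM R (m * n)))) <= (expR (- (t ^+ 2 /
    (4 * (3 * pi ^+ 2 * (3 + 4 * ln (max_rank K)%:R ^+ 2) / (2 * (D%:R + 1)))))))%:E)%E.
  apply: (entN_deviation haar_mu phi0K phi01 mbad t0 (N := N)) => U /= bad GU.
  have u : unit_vector (U *m phi0).
    by apply: unit_dot; rewrite (unitary_group_dot _ _ GU).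
  move/negP: bad; rewrite -ltNge => bad.
  apply: le_trans (entN_le_ent_entropy N u) _.
  have h1 := Ex_entN_ge N; have h2 := ler_wpM2l (ltW l0) (ltW bad).
  rewrite (mulrBr (ln 2) (Sbar K) eps) in h2; move: h1 h2 hN; rewrite /t.
  move: (Ex _ _ _) (ln 2 * Sbar K) (ln 2 * ent_entropy _) (ln 2 * eps) (_ / N.+1%:R).
  by move=> a b c d e; lra.
have [x xE] : exists x : R, mu (~` (good : set (borelM R (m * n)))) = x%:E.
  exists (fine (mu (~` (good : set (borelM R (m * n)))))).
  by rewrite fineK// fin_num_measure.
have -> : mu good = (1 - x)%:E.
  rewrite EFinB -xE -[X in mu X]setCK; exact: probability_setC.
move: dev; rewrite xE lee_fin lte_fin ltrD2l ltrN2 => dev.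
apply: le_lt_trans dev _; rewrite ltr_expR ltrN2.
have d0 : 0 < D%:R + 1 :> R by rewrite ltr_wpDl.
have := max_rank_gt0 phi0K (unit_dot phi01); rewrite leq_eqVlt => /predU1P[<-|r1].
  (* Since [ln 1 = 0] and [x / 0 = 0], the bound to be beaten is 0 here. *)
  rewrite ln1 expr0n mulr0 invr0 mulr0 mulr0 addr0 divr_gt0 ?exprn_gt0//.
  by rewrite mulr_gt0// divr_gt0 ?mulr_gt0 ?exprn_gt0 ?pi_gt0.
apply: exponent_lt => //; rewrite ler_ln ?posrE ?ler_nat// ltr0n.
exact: ltn_trans r1.
Qed.

End LowerTail.

Theorem theorem2 (R : realType) (d nA nB : nat) (le_nA_nB : (nA <= nB)%N)
    (K : {vspace 'cV[Cx R]_(d ^ nA * d ^ nB)})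
    (mu : probability (borelM R (d ^ nA * d ^ nB)) R) (haar_mu : is_haar K mu)
    (phi0 : 'cV[Cx R]_(d ^ nA * d ^ nB))
    (phi0_in_K : phi0 \in K) (phi0_unit : unit_vector phi0)
    (eps : R) (eps_gt0 : 0 < eps) :
  (mu [set U : 'M[Cx R]_(d ^ nA * d ^ nB) |
         (Sbar K - eps <= ent_entropy (U *m phi0))%R]
   > (1 - expR (- (((\dim K)%:R + 1) * eps ^+ 2
                   / (72 * pi ^+ 3 * ln 2 * ln (max_rank K)%:R ^+ 2))))%:E)%E.
Proof.
exact: (ent_entropy_concentration haar_mu phi0_in_K (dot_unit phi0_unit) eps_gt0).
Qed.
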